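(* Let $Z_{\widetilde I}=\sum_{[G]}Z^{G,or(G)}_{\widetilde I}(G,or(G))$ be the cochain of the dual ribbon graph complex $(C^*,d)$ given by the partition functions of connected ribbon graphs. Its boundary is given by the sum over graphs with loops, $$dZ_{\widetilde I}=\sum_{[G],\,Loop(G)\ne\varnothing}(G,or(G))\,Z^{\mathrm{loop},(G,or(G))}_{\widetilde I},$$ each such graph with loops contributing $$Z^{\mathrm{loop},(G,or(G))}_{\widetilde I}=-\Big\langle\Big(\bigotimes_{e\in Edge_r(G)}(g^{-1}_{\widetilde I})_e\Big)\,I\Big(\bigotimes_{l\in Loop(G)}(g^{-1}_{\widetilde I})_l\Big),\ \bigotimes_{v\in Vert(G)}\alpha_v\Big\rangle .$$
   Context: **Algebraic data.** $k$ is a field of characteristic $0$. $A$ is a finite-dimensional $\mathbb Z/2\mathbb Z$-graded associative $k$-algebra with a nondegenerate odd bilinear form $g$ satisfying $g(ab,c)=g(a,bc)$, $g(a,b)=(-1)^{\bar a\bar b}g(b,a)$. $I$ is an odd derivation of $A$ with $g(Ix,y)+(-1)^{\bar x}g(x,Iy)=0$. $\widetilde I$ is an odd operator with $g(\widetilde Ix,y)=(-1)^{\bar x}g(x,\widetilde Iy)$ and $[I,\widetilde I]=I\widetilde I+\widetilde II=1$. $\Pi$ is parity reversal and $\pi a\in\Pi A$ is $a$ with reversed parity. **Ribbon graph complex.** A ribbon graph $G$ is a finite set $Flag(G)$ with a permutation $\sigma$ all of whose cycles have length $\ge3$ (cycles = vertices; $Flag(v)$, $n(v)=|Flag(v)|$)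 and a fixed-point free involution $\eta$ (orbits = edges). $Loop(G)$ is the set of edges that are loops, $Edge_r(G)$ the set of the other (regular) edges. An orientation $or(G)$ is an orientation of $\bigotimes_v(k^{Flag(v)}\oplus k)$ (tensor product of determinant lines); equivalently, a choice of a flag at each even-valent vertex and an order on the set of even-valent vertices (the wedge over vertices $v=(f_1\dots f_r)$ of $v\wedge f_1\wedge\dots\wedge f_r$). The complex is spanned by classes of connected $(G,or(G))$ modulo $(G,-or)=-(G,or)$, with $D(G,or(G))=\sum_{e\in Edge_r(G)}(G/\{e\},\text{induced orientation})$, where for $e=(ff')$, $f\in v_1=(f\,A)$, $f'\in v_2=(f'\,B)$, the new vertex is $v_0=(A\,B)$ and the induced orientation is $v_1\wedge f\wedge v_2\wedge f'\wedge\omega\mapsto v_0\wedge\omega$. $(C^*,d)$ is the dual complex; a cochain $\sum_{[G]}z^{(G,or(G))}(G,or(G))$ is the functional with value $z^{(G,or(G))}$ on $(G,or(G))$. **Partition function.** $P:A\to\Pi\,\mathrm{Hom}(A,k)$ is induced by $g$; $g^{-1}(\varphi,\psi)=g(P^{-1}\varphi,P^{-1}\psi)$; $\widetilde I^*\varphi(a)=(-1)^{\bar\varphi}\varphi(\widetilde Ia)$; $g^{-1}_{\widetilde I}(\varphi,\psi)=g^{-1}(\widetilde I^*\varphi,\psi)$, an even symmetric element of $(\Pi A)^{\otimes2}$, with copy $(g^{-1}_{\widetilde I})_e$ for each edge. $\alpha_n(\pi a_1,\dots,\pi a_n)=(-1)^{\sum_{i=1}^{n-1}\sum_{j=1}^i\bar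 a_j}g(a_1\cdots a_{n-1},a_n)$, and $\alpha_v\in\mathrm{Hom}((\Pi A)^{\otimes Flag(v)},k)$ is its copy with $n=n(v)$ (for even $n(v)$ starting from the chosen flag; the odd factors, those with $n(v)$ even, are multiplied in the order given by $or(G)$). $Z^{G,or(G)}_{\widetilde I}=\langle\bigotimes_v\alpha_v,\bigotimes_e(g^{-1}_{\widetilde I})_e\rangle$. $I$ acts on tensor powers of $\Pi A$ as the derivation (graded Leibniz rule) extending its action on $\Pi A$. *)

(* Defs.v *)
From HB Require Import structures.
From mathcomp Require Import all_boot all_order all_algebra all_fingroup.

Set Implicit Arguments.
Unset Strict Implicit.
Unset Printing Implicit Defensive.

Import GRing.Theory.
Local Open Scope ring_scope.

(* Parities are booleans: [false] is even and [true] is odd.  The scalar      *)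
(* (-1) ^+ b with b : bool uses the coercion of bool to nat.                   *)

(* The algebra is not assumed to be unital. *)
Record super_data (k : fieldType) := SuperData {
  carrier :> vectType k;
  part : bool -> {vspace carrier};
  mul : {bilinear carrier -> carrier -> carrier};
  form : {biscalar carrier};
  opI : 'End(carrier);
  opIt : 'End(carrier);
  part_full : (part false + part true)%VS = fullv;
  part_direct : (part false :&: part true)%VS = 0%VS;
  mul_graded : forall s t a b,
    a \in part s -> b \in part t -> mul a b \in part (s (+) t);
  mul_assoc : associative mul;
  form_odd : forall s a b, a \in part s -> b \in part s -> form a b = 0;
  form_nondeg : forall a, (forall b, form a b = 0) -> a = 0;
  form_inv : forall a b c, form (mul a b) c = form a (mul b c);
  form_sym : forall s t a b, a \in part s -> b \in part t ->
    form a b = (-1) ^+ (s && t) * form b a;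
  opI_odd : forall s a, a \in part s -> opI a \in part (~~ s);
  opI_der : forall s a b, a \in part s ->
    opI (mul a b) = mul (opI a) b + (-1) ^+ s *: mul a (opI b);
  opI_form : forall s a b, a \in part s ->
    form (opI a) b + (-1) ^+ s * form a (opI b) = 0;
  opIt_odd : forall s a, a \in part s -> opIt a \in part (~~ s);
  opIt_form : forall s a b, a \in part s ->
    form (opIt a) b = (-1) ^+ s * form a (opIt b);
  opI_opIt : forall a, opI (opIt a) + opIt (opI a) = a
}.

Record homog_basis (k : fieldType) (A : super_data k) := HomogBasis {
  bdim : nat;
  bvec : bdim.-tuple A;
  bpar : 'I_bdim -> bool;
  bvecP : basis_of fullv bvec;
  bparP : forall i, tnth bvec i \in part A (bpar i)
}.

Lemma homog_basis_exists (k : fieldType) (A : super_data k) :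
  inhabited (homog_basis A).
Proof.
pose X0 := vbasis (part A false); pose X1 := vbasis (part A true).
have direct01 : directv (part A false + part A true).
  by apply/directv_addP; exact: part_direct.
have basisX : basis_of fullv [tuple of X0 ++ X1].
  by rewrite -(part_full A); apply: cat_basis => //; exact: vbasisP.
pose par (i : 'I_(\dim (part A false) + \dim (part A true))) :=
  (\dim (part A false) <= i)%N.
suff parP i : tnth [tuple of X0 ++ X1] i \in part A (par i).
  by constructor; exact: HomogBasis basisX parP.
rewrite (tnth_nth 0) /= nth_cat size_tuple ltnNge -/(par i).
case: (boolP (par i)) => pari; apply: vbasis_mem; apply: mem_nth.
  by rewrite size_tuple ltn_subLR.
by rewrite size_tuple ltnNge.
Qed.

Record ribbon_graph := RibbonGraph {
  flag : finType;
  sigma : {perm flag};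
  eta : {perm flag};
  sigma_ge3 : forall f, (3 <= #|porbit sigma f|)%N;
  eta_nofix : forall f, eta f != f;
  eta_invol : involutive eta
}.

Definition vertices (G : ribbon_graph) : {set {set flag G}} :=
  porbits (sigma G).

Definition edge (G : ribbon_graph) := {e : {set flag G} | e \in porbits (eta G)}.

Definition is_loop (G : ribbon_graph) (e : edge G) : bool :=
  [exists v in vertices G, val e \subset v].

Definition reg_edge (G : ribbon_graph) := {e : edge G | ~~ is_loop e}.
Definition loop_edge (G : ribbon_graph) := {e : edge G | is_loop e}.

Definition connected (G : ribbon_graph) : Prop :=
  (0 < #|flag G|)%N /\
  forall f h : flag G,
    connect [rel a b | (b == sigma G a) || (b == eta G a)] f h.

Lemma edge_nonempty (G : ribbon_graph) (e : edge G) : exists f, f \in val e.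
Proof. by case: e => _ /= /imsetP[f _ ->]; exists f; exact: porbit_id. Qed.

Definition edge_flag (G : ribbon_graph) (e : edge G) : flag G :=
  xchoose (edge_nonempty e).

(* The flags of the vertex of f, in cyclic order starting from f. *)
Definition vertex_flags (G : ribbon_graph) (f : flag G) : seq (flag G) :=
  traject (sigma G) f #|porbit (sigma G) f|.

Section Contraction.

Variables (G : ribbon_graph) (e : reg_edge G).
Let E : {set flag G} := val (val e).

Lemma porbit_eta (f : flag G) : porbit (eta G) f =i [:: f; eta G f].
Proof.
move=> x; rewrite !inE; apply/porbitP/orP => [[i ->]|[]/eqP->].
- elim: i => [|i IHi]; first by rewrite expg0 perm1 eqxx; left.
  rewrite expgSr permM; case: IHi => /eqP->; first by rewrite eqxx; right.
  by rewrite eta_invol eqxx; left.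
- by exists 0; rewrite expg0 perm1.
- by exists 1; rewrite expg1.
Qed.

Lemma edge_mem f : f \in E -> E =i [:: f; eta G f].
Proof.
have /imsetP[h _ ->] : E \in porbits (eta G) := valP (val e).
by rewrite -eq_porbit_mem => /eqP <-; exact: porbit_eta.
Qed.

Lemma edge_eta f : f \in E -> eta G f \in E.
Proof. by move=> fE; rewrite (edge_mem fE) !inE eqxx orbT. Qed.

Lemma edge_reg f : f \in E -> eta G f \notin porbit (sigma G) f.
Proof.
move=> fE; apply: contra (valP e) => efv; apply/existsP.
exists (porbit (sigma G) f); rewrite imset_f //=.
by apply/subsetP => x; rewrite (edge_mem fE) !inE => /orP[]/eqP-> //;
   exact: porbit_id.
Qed.

Lemma sigma_neq (f : flag G) : sigma G f != f.
Proof.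
apply: contraTneq (sigma_ge3 f) => sf; have := uniq_traject_porbit (sigma G) f.
by case: #|_| => [|[|n]] //=; rewrite sf inE eqxx.
Qed.

Lemma sigma2_neq (f : flag G) : sigma G (sigma G f) != f.
Proof.
apply: contraTneq (sigma_ge3 f) => sf; have := uniq_traject_porbit (sigma G) f.
by case: #|_| => [|[|[|n]]] //=; rewrite sf !inE eqxx !orbT.
Qed.

Lemma porbit_ge3 (T : finType) (s : {perm T}) x :
  s x != x -> s (s x) != x -> (3 <= #|porbit s x|)%N.
Proof.
move=> s1 s2; have := iter_porbit s x; have := card_porbit_neq0 s x.
by case: #|_| => [|[|[|n]]] //= _ /eqP; rewrite ?(negPf s1) ?(negPf s2).
Qed.

(* Successor in the cyclic order (A B), for vertices (f A) and (f' B). *)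
Definition skip (x : flag G) : flag G :=
  let y := sigma G x in if y \in E then sigma G (eta G y) else y.

Let porbit_sigma (x : flag G) : porbit (sigma G) (sigma G x) = porbit (sigma G) x.
Proof. by have := porbit_perm (sigma G) 1 x; rewrite expg1. Qed.

Lemma sigma_eta_notin y : y \in E -> sigma G y \notin E.
Proof.
move=> yE; rewrite (edge_mem yE) !inE negb_or sigma_neq /=.
apply: contraNneq (edge_reg yE) => <-.
by rewrite -eq_porbit_mem porbit_sigma.
Qed.

Lemma skip_notin x : skip x \notin E.
Proof.
rewrite /skip; case: ifPn => // yE; apply: sigma_eta_notin; exact: edge_eta.
Qed.

Definition cflag := {x : flag G | x \notin E}.

Definition csigma_fun (x : cflag) : cflag := exist _ (skip (val x)) (skip_notin _).

Lemma csigma_inj : injective csigma_fun.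
Proof.
move=> x y /(congr1 val) /=; rewrite /skip => eqs; apply: val_inj.
case: ifPn eqs => xE; case: ifPn => yE.
- by move/perm_inj/perm_inj/perm_inj.
- move/perm_inj=> eqs; case/negP: (valP y).
  by rewrite -[val y]/(sval y) -eqs; exact: edge_eta.
- move/perm_inj=> eqs; case/negP: (valP x).
  by rewrite -[val x]/(sval x) eqs; exact: edge_eta.
- by move/perm_inj.
Qed.

Definition csigma : {perm cflag} := perm csigma_inj.

Lemma ceta_notin (x : cflag) : eta G (val x) \notin E.
Proof. by apply: contra (valP x) => /edge_eta; rewrite eta_invol. Qed.

Definition ceta_fun (x : cflag) : cflag := exist _ (eta G (val x)) (ceta_notin x).

Lemma ceta_inj : injective ceta_fun.
Proof. by move=> x y /(congr1 val) /= /perm_inj /val_inj. Qed.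

Definition ceta : {perm cflag} := perm ceta_inj.

Lemma csigma_ge3 x : (3 <= #|porbit csigma x|)%N.
Proof.
have neqE y z : y \in E -> z \in porbit (sigma G) y ->
    sigma G (eta G y) != z.
  move=> yE zy; apply: contraNneq (edge_reg yE) => eqz.
  by rewrite -eq_porbit_mem -[porbit _ (eta _ _)]porbit_sigma eqz eq_porbit_mem.
have memS (z : flag G) : z \in porbit (sigma G) (sigma G z).
  by rewrite -eq_porbit_mem porbit_sigma.
have memSS (z : flag G) : z \in porbit (sigma G) (sigma G (sigma G z)).
  by rewrite -eq_porbit_mem !porbit_sigma.
apply: porbit_ge3; rewrite -val_eqE !permE /=.
  by rewrite /skip; case: ifPn => [yE|_]; [exact: neqE | exact: sigma_neq].
rewrite /skip; case: (ifPn (sigma G (val x) \in E)) => yE; last first.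
  by case: ifPn => [zE|_]; [exact: neqE | exact: sigma2_neq].
case: ifPn => [zE|_].
  have: sigma G (sigma G (eta G (sigma G (val x)))) \in
        porbit (sigma G) (eta G (sigma G (val x))).
    by rewrite -eq_porbit_mem !porbit_sigma.
  move: zE; rewrite (edge_mem yE) !inE => /orP[] /eqP->.
    by rewrite -eq_porbit_mem eq_sym eq_porbit_mem (negPf (edge_reg yE)).
  by rewrite eta_invol sigma2_neq.
apply: contraNneq (edge_reg yE) => eqx.
rewrite -eq_porbit_mem -[porbit _ (eta _ _)]porbit_sigma -porbit_sigma eqx.
by rewrite porbit_sigma.
Qed.

Lemma ceta_nofix x : ceta x != x.
Proof. by rewrite -val_eqE permE /= eta_nofix. Qed.

Lemma ceta_invol : involutive ceta.
Proof. by move=> x; apply: val_inj; rewrite !permE /= eta_invol. Qed.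

Definition contract : ribbon_graph :=
  RibbonGraph csigma_ge3 ceta_nofix ceta_invol.

End Contraction.

(* Sign of the permutation taking the duplicate-free word s to its            *)
(* rearrangement t, as the parity of the number of inversions.                *)
Fixpoint inversions (s : seq nat) : nat :=
  if s is x :: s' then (count (fun y => (y < x)%N) s' + inversions s')%N else 0%N.

Definition reorder_sign (T : eqType) (s t : seq T) : bool :=
  odd (inversions [seq index x s | x <- t]).

(* The tensor product over v of the determinant lines of k^Flag(v) (+) k is   *)
(* the determinant line of the space with basis Flag(G) and Vert(G); the      *)
(* letter [inl f] is the flag f and [inr v] is the vertex v.  An orientation  *)
(* is the wedge product, in the given order, of a word in which every letter  *)
(* occurs exactly once; an odd permutation of the word gives the opposite     *)
(* orientation.                                                               *)
Definition letter (G : ribbon_graph) := (flag G + {set flag G})%type.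

Definition letters (G : ribbon_graph) : seq (letter G) :=
  [seq inl f | f <- enum (flag G)] ++ [seq inr v | v <- enum (vertices G)].

Definition is_orientation (G : ribbon_graph) (w : seq (letter G)) : bool :=
  perm_eq w (letters G).

Definition graph_iso (G H : ribbon_graph) (phi : flag G -> flag H) : Prop :=
  [/\ bijective phi,
      forall f, phi (sigma G f) = sigma H (phi f) &
      forall f, phi (eta G f) = eta H (phi f)].

Definition map_letter (G H : ribbon_graph) (phi : flag G -> flag H)
    (a : letter G) : letter H :=
  match a with inl f => inl (phi f) | inr v => inr [set phi f | f in v] end.

Section InducedOrientation.

Variables (G : ribbon_graph) (e : reg_edge G).

(* The word v1, f, v2, f' for e = (f f'), f in v1, f' in v2. *)
Definition edge_word : seq (letter G) :=
  let f := edge_flag (val e) in let f' := eta G f in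
  [:: inr (porbit (sigma G) f); inl f; inr (porbit (sigma G) f'); inl f'].

Definition rest_word (w : seq (letter G)) : seq (letter G) :=
  [seq a <- w | a \notin edge_word].

Definition contract_letter (a : letter G) : option (letter (contract e)) :=
  match a with
  | inl f => omap inl (insub f)
  | inr v => Some (inr [set x : flag (contract e) | val x \in v])
  end.

Definition new_vertex : {set flag (contract e)} :=
  let f := edge_flag (val e) in
  [set x : flag (contract e) |
     val x \in porbit (sigma G) f :|: porbit (sigma G) (eta G f)].

(* w = (-1) ^+ induced_sign w . v1 /\ f /\ v2 /\ f' /\ omega *)
Definition induced_sign (w : seq (letter G)) : bool :=
  reorder_sign w (edge_word ++ rest_word w).

(* v0 /\ omega *)
Definition induced_word (w : seq (letter G)) : seq (letter (contract e)) :=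
  inr new_vertex :: pmap contract_letter (rest_word w).

End InducedOrientation.

(* A cochain is given by its values on connected oriented ribbon graphs; the  *)
(* values at disconnected graphs and at words that are not orientations are   *)
(* irrelevant.                                                                *)
Definition precochain (k : fieldType) :=
  forall G : ribbon_graph, seq (letter G) -> k.

Definition is_cochain (k : fieldType) (z : precochain k) : Prop :=
  (forall (G : ribbon_graph) (w w' : seq (letter G)),
     connected G -> is_orientation w -> is_orientation w' ->
     z G w' = (-1) ^+ reorder_sign w w' * z G w) /\
  (forall (G H : ribbon_graph) (phi : flag G -> flag H) (w : seq (letter G)),
     connected G -> is_orientation w -> graph_iso phi ->
     z H (map (map_letter phi) w) = z G w).

Definition cochain_eq (k : fieldType) (z1 z2 : precochain k) : Prop :=
  forall (G : ribbon_graph) (w : seq (letter G)),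
    connected G -> is_orientation w -> z1 G w = z2 G w.

Definition dual_d (k : fieldType) (z : precochain k) : precochain k :=
  fun G w =>
    \sum_(e : reg_edge G) (-1) ^+ induced_sign e w * z (contract e) (induced_word e w).

(* Starting flags of all the vertices, in an order, such that w is plus or    *)
(* minus the wedge over these vertices v = (f_1 ... f_r), in this order, of   *)
(* v /\ f_1 /\ ... /\ f_r: the vertices are ordered by their occurrence in w,  *)
(* and f_1 is the first flag of v occurring in w.  The odd-valent vertices    *)
(* are listed as well, their factors being even and cyclically invariant.     *)
Definition frame (G : ribbon_graph) (w : seq (letter G)) : seq (flag G) :=
  let flags := pmap (fun a => if a is inl f then Some f else None) w in
  let verts := pmap (fun a => if a is inr v then Some v else None) w in
  pmap (fun v : {set flag G} => ohead [seq f <- flags | f \in v]) verts.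

Definition frame_word (G : ribbon_graph) (s : seq (flag G)) : seq (letter G) :=
  flatten [seq inr (porbit (sigma G) f) :: [seq inl h | h <- vertex_flags f]
          | f <- s].

Section PartitionFunction.

Variables (k : fieldType) (A : super_data k) (b : homog_basis A).

Local Notation N := (bdim b).

(* Elements of Pi Hom(A, k) are linear forms on A; parities of linear forms   *)
(* below are those in Pi Hom(A, k).                                           *)
Definition formP : 'Hom(A, 'Hom(A, k^o)) :=
  linfun (fun a : A => linfun (form A a : A -> k^o)).

Definition form_inverse (phi psi : 'Hom(A, k^o)) : k :=
  form A (formP^-1%VF phi) (formP^-1%VF psi).

Definition opIt_dual (s : bool) (phi : 'Hom(A, k^o)) : 'Hom(A, k^o) :=
  linfun (fun a : A => (-1) ^+ s * phi (opIt A a) : k^o).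

Definition form_inverse_It (s : bool) (phi psi : 'Hom(A, k^o)) : k :=
  form_inverse (opIt_dual s phi) psi.

Definition dual_vec (i : 'I_N) : 'Hom(A, k^o) :=
  linfun (coord (bvec b) i : A -> k^o).

(* The parity of pi e_i, and also of e^i in Pi Hom(A, k). *)
Definition ppar (i : 'I_N) : bool := ~~ bpar i.

(* Coefficient of pi e_i (x) pi e_j in the element of Pi A (x) Pi A whose     *)
(* value on phi (x) psi, with the sign rule                                   *)
(* (phi (x) psi)(x (x) y) = (-1)^(psi x) phi(x) psi(y), is                    *)
(* g^-1_It(phi, psi).                                                         *)
Definition prop_coef (i j : 'I_N) : k :=
  (-1) ^+ (ppar i && ppar j) *
  form_inverse_It (ppar i) (dual_vec i) (dual_vec j).

(* alpha_n(pi e_{i_1}, ..., pi e_{i_n}), where s = [:: i_1; ...; i_n]. *)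
Definition alpha (s : seq 'I_N) : k :=
  let a := [seq tnth (bvec b) i | i <- s] in
  let p := [seq bpar i | i <- s] in
  let n := size s in
  (-1) ^+ (\sum_(1 <= i < n) \sum_(0 <= j < i) nth false p j)%N *
  form A (foldl (mul A) (head 0 a) (take (n - 2) (behead a))) (last 0 a).

Section Graph.

Variable G : ribbon_graph.

(* An element of the tensor power of Pi A over a set of flags listed as u is  *)
(* given by its coefficients: t x is the coefficient of the tensor product,   *)
(* in the order u, of the vectors pi e_(x f), and only depends on the values  *)
(* of x at the flags f of u.                                                  *)
Definition tensor := (flag G -> 'I_N) -> k.

Definition edge_order (es : seq (edge G)) : seq (flag G) :=
  flatten [seq [:: edge_flag e; eta G (edge_flag e)] | e <- es].

Definition edge_tensor (es : seq (edge G)) : tensor := fun x =>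
  \prod_(e <- es) prop_coef (x (edge_flag e)) (x (eta G (edge_flag e))).

(* I acts on Pi A by I (pi a) = pi (I a). *)
Definition act_I (u : seq (flag G)) (t : tensor) : tensor := fun x =>
  \sum_(f <- u)
    (-1) ^+ (\sum_(h <- take (index f u) u) ppar (x h))%N *
    \sum_(i : 'I_N) coord (bvec b) (x f) (opI A (tnth (bvec b) i)) *
      t [eta x with f |-> i].

(* The tensor t, listed in the order u, is first rearranged to the order      *)
(* given by the vertices, with the sign of the permutation of its odd         *)
(* factors; then each alpha_v is applied to the factors at its own flags, and *)
(* the values are multiplied without further signs.                           *)
Definition pairing (s u : seq (flag G)) (t : tensor) : k :=
  let vs := flatten [seq vertex_flags f | f <- s] in
  \sum_(x : {ffun flag G -> 'I_N})
    (-1) ^+ reorder_sign [seq f <- u | ppar (x f)] [seq f <- vs | ppar (x f)] *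
    t x * \prod_(f <- s) alpha [seq x h | h <- vertex_flags f].

Definition orient_pairing (w : seq (letter G)) (u : seq (flag G)) (t : tensor) : k :=
  (-1) ^+ reorder_sign w (frame_word (frame w)) * pairing (frame w) u t.

Definition all_edges : seq (edge G) := enum {: edge G}.
Definition reg_edges : seq (edge G) := [seq val e | e <- enum {: reg_edge G}].
Definition loop_edges : seq (edge G) := [seq val e | e <- enum {: loop_edge G}].

Definition partition_value (w : seq (letter G)) : k :=
  orient_pairing w (edge_order all_edges) (edge_tensor all_edges).

Definition loop_value (w : seq (letter G)) : k :=
  - orient_pairing w (edge_order reg_edges ++ edge_order loop_edges)
      (fun x => edge_tensor reg_edges x *
                act_I (edge_order loop_edges) (edge_tensor loop_edges) x).

End Graph.

Definition Z_It : precochain k := fun G w => partition_value w.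

Definition Z_loop : precochain k := fun G w =>
  if (0 < #|{: loop_edge G}|)%N then loop_value w else 0.

End PartitionFunction.

(* Main.v *)
(* Write Z(e) for the pairing of the vertex tensors with the edge tensors in
   which the bivector of the edge e is replaced by I applied to it.  Since
   [I, It] = 1, that replacement is the inverse g^-1 of the odd form
   ([opI_prop_coef]), and gluing two distinct vertices along g^-1 multiplies
   the cyclic words at their ends ([alpha_inv_coef]): for a regular edge e,
   Z(e) is the partition function of G / e.  The vertex tensors are I-closed,
   because I is a derivation preserving the form, so the sum of Z(e) over all
   edges vanishes; hence the sum over regular edges is minus the sum over
   loops, which is the loop term.

   Every sign is that of a permutation of a word.  All comparisons between
   choices (starting flags, orders of vertices, orientations of edges) reduce
   to rotating or transposing blocks of such words ([prod_blocks]). *)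
From HB Require Import structures.
From mathcomp Require Import all_boot all_order all_algebra all_fingroup ring.
Require Import Defs.

Set Implicit Arguments.
Unset Strict Implicit.
Unset Printing Implicit Defensive.

Import GRing.Theory.
Local Open Scope ring_scope.

(** * Signs of rearrangements *)

(** The obstacle is that Koszul signs depend on the basis indices being summed, while orientation
    signs do not. They become comparable because the form is odd: where alpha_n does not vanish, the
    number of its odd arguments in Pi A is n + 1 modulo 2, and n + 1 is the length of the
    orientation word of a vertex and its n flags. Transposing two vertices therefore gives the same
    sign in the word of tensor factors and in the orientation word. Likewise an unmarked edge is an
    even block of factors and a marked edge an odd one, and at most one edge is ever marked. So
    signs are compared one summand at a time, once vanishing factors are set aside. Since a marked
    value depends neither on the starting flags nor on the listing of the edges, every computation
    may use a convenient choice. For the contraction of e = (f0 f1) this is a frame beginning with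
    f0 and f1 and an edge list beginning with f0: the blocks v1 f0 A and v2 f1 B then become v0 A
    B. *)

Section ReorderSign.

Implicit Type T : eqType.

Lemma inversions_cat (s t : seq nat) :
  inversions (s ++ t) =
    (inversions s + inversions t + \sum_(x <- s) count (fun y => (y < x)%N) t)%N.
Proof.
elim: s => [|x s IHs] /=; first by rewrite big_nil addn0.
by rewrite big_cons IHs count_cat !addnA; congr (_ + _)%N; rewrite -!addnA;
   congr (_ + _)%N; rewrite addnC -addnA.
Qed.

Lemma inversions_mono (T : Type) (f g : T -> nat) (s : seq T) :
  (forall x y, (f x < f y)%N = (g x < g y)%N) ->
  inversions (map f s) = inversions (map g s).
Proof.
move=> fg; elim: s => //= x s ->; congr (_ + _)%N.
by rewrite !count_map; apply: eq_count => y /=; rewrite fg.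
Qed.

Lemma inversions_iota m n : inversions (iota m n) = 0%N.
Proof.
elim: n m => //= n IHn m; rewrite IHn addn0; apply/eqP.
rewrite -leqn0 leqNgt -has_count; apply/hasPn => y.
by rewrite mem_iota => /andP[my _]; rewrite -leqNgt ltnW.
Qed.

Lemma map_index_uniq T (s : seq T) : uniq s -> map (index^~ s) s = iota 0 (size s).
Proof.
case: s => // x0 s' us; set s := x0 :: s' in us *.
apply: (@eq_from_nth _ 0%N); first by rewrite size_map size_iota.
move=> i; rewrite size_map => ltis.
by rewrite (nth_map x0) // nth_iota // index_uniq.
Qed.

Lemma map_index_catl T (s t u : seq T) : {subset u <= s} ->
  map (index^~ (s ++ t)) u = map (index^~ s) u.
Proof. by move=> us; apply/eq_in_map => x /us xs; rewrite index_cat xs. Qed.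

Lemma map_index_catr T (s t u : seq T) : uniq (s ++ t) -> {subset u <= t} ->
  map (index^~ (s ++ t)) u = map (addn (size s)) (map (index^~ t) u).
Proof.
rewrite cat_uniq => /and3P[_ /hasPn st _] ut.
by rewrite -map_comp; apply/eq_in_map => x /ut /st /negPf xs; rewrite index_cat xs.
Qed.

Lemma reorder_sign_refl T (s : seq T) : uniq s -> reorder_sign s s = false.
Proof. by move=> us; rewrite /reorder_sign map_index_uniq ?inversions_iota. Qed.

(** In [s ++ t] every letter of [t'] has a larger index than every letter of [s'], so no inversion
    mixes the two parts. *)
Lemma reorder_sign_cat T (s s' t t' : seq T) : uniq (s ++ t) ->
  perm_eq s s' -> perm_eq t t' ->
  reorder_sign (s ++ t) (s' ++ t') = reorder_sign s s' (+) reorder_sign t t'.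
Proof.
move=> ust ss' tt'; rewrite /reorder_sign map_cat.
rewrite map_index_catl; last by move=> x; rewrite (perm_mem ss').
rewrite map_index_catr //; last by move=> x; rewrite (perm_mem tt').
rewrite inversions_cat big1_seq ?addn0 ?oddD; last first.
  move=> i /andP[_ /mapP[x]]; rewrite -(perm_mem ss') -index_mem => xs ->.
  rewrite -map_comp count_map; apply/eqP; rewrite -leqn0 leqNgt -has_count.
  by apply/hasPn => y _ /=; rewrite -leqNgt (leq_trans (ltnW xs)) ?leq_addr.
congr (_ (+) odd _); rewrite -[in RHS](map_id (map _ t')).
by apply: inversions_mono => x y; rewrite ltn_add2l.
Qed.

Lemma reorder_sign_swap T (s t : seq T) : uniq (s ++ t) ->
  reorder_sign (s ++ t) (t ++ s) = odd (size s) && odd (size t).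
Proof.
move=> ust; have := ust; rewrite cat_uniq => /and3P[us _ ut].
rewrite /reorder_sign map_cat map_index_catr // map_index_catl // !map_index_uniq //.
rewrite -iotaDl addn0 inversions_cat !inversions_iota !add0n.
rewrite (eq_big_seq (fun=> size s)) => [|x].
  by rewrite big_const_seq count_predT size_iota iter_addn_0 oddM.
rewrite mem_iota => /andP[sx _]; rewrite -[RHS](size_iota 0) -[RHS]count_predT.
apply: eq_in_count => y; rewrite mem_iota add0n => /andP[_ ys].
by rewrite (leq_trans ys sx).
Qed.

Lemma reorder_sign_map T T' (f : T -> T') (s t : seq T) : injective f ->
  reorder_sign (map f s) (map f t) = reorder_sign s t.
Proof.
move=> injf; rewrite /reorder_sign -map_comp; congr (odd (inversions _)).
by apply: eq_map => x /=; rewrite index_map.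
Qed.

Let addb_eq0 a b : a (+) b = false -> a = b.
Proof. by case: a b => [] []. Qed.

Let before T (s : seq T) x y := (index x s < index y s)%N.

Let before_asym T (s : seq T) x y :
  x \in s -> x != y -> before s y x = ~~ before s x y.
Proof.
rewrite /before => xs xy; rewrite -leqNgt ltn_neqAle andb_idl // => _.
apply: contra xy => /eqP eqi; apply/eqP; rewrite -(nth_index x xs) -eqi nth_index //.
by rewrite -index_mem eqi index_mem.
Qed.

(** Off the diagonal every unordered pair is counted twice. *)
Let big_addb_sym T (r : seq T) (F : T -> T -> bool) :
  {in r &, forall x y, F x y = F y x} -> {in r, forall x, F x x = false} ->
  \big[addb/false]_(x <- r) \big[addb/false]_(y <- r) F x y = false.
Proof.
elim: r => [|a r IHr] Fsym Fdiag; first by rewrite big_nil.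
rewrite !big_cons Fdiag ?mem_head // addFb.
rewrite [X in _ (+) X](eq_bigr
  (fun x => F x a (+) \big[addb/false]_(y <- r) F x y)); last first.
  by move=> x _; rewrite big_cons.
rewrite big_split /= IHr ?addbF; first last.
- by move=> x xr; apply: Fdiag; rewrite inE xr orbT.
- by move=> x y xr yr; apply: Fsym; rewrite inE ?xr ?yr orbT.
rewrite [X in _ (+) X](eq_big_seq (fun x => F a x)) ?addbb // => x xr.
by rewrite Fsym ?mem_head // inE xr orbT.
Qed.

Let reorder_signE T (s t : seq T) : uniq t ->
  reorder_sign s t =
    \big[addb/false]_(x <- t) \big[addb/false]_(y <- t) (before t x y && before s y x).
Proof.
rewrite /reorder_sign /before.
have odd_count (l : seq nat) (a : pred nat) :
    odd (count a l) = \big[addb/false]_(y <- l) a y.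
  by elim: l => [|y l IHl]; rewrite ?big_nil // big_cons /= oddD IHl; case: (a y).
elim: t => [|a t IHt] /=; first by rewrite big_nil.
case/andP => at' ut; rewrite oddD IHt // {IHt}.
rewrite big_cons big_cons /= eqxx ltnn /= odd_count big_map.
congr (_ (+) _).
  apply: eq_big_seq => y yt /=; case: eqVneq => // eqy.
  by rewrite eqy yt in at'.
apply: eq_big_seq => x xt; rewrite big_cons.
have ax: (a == x) = false by apply: contraNF at' => /eqP->.
rewrite ax eqxx /=; apply: eq_big_seq => y yt.
by have /negPf-> : a != y by apply: contraNneq at' => ->.
Qed.

(** The sign is the parity of the number of unordered pairs on which [s] and [t] disagree, and these
    pairs may be enumerated by any reference order [r]. With [r] fixed, disagreement is additive
    modulo 2, which gives transitivity of the sign at once. *)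
Let reorder_sign_pairs T (r s t : seq T) : uniq r -> perm_eq s r -> perm_eq t r ->
  reorder_sign s t =
    \big[addb/false]_(x <- r) \big[addb/false]_(y <- r)
      (before r x y && (before s x y (+) before t x y)).
Proof.
move=> ur sr tr; have ut : uniq t by rewrite (perm_uniq tr).
have tE := perm_mem tr; have sE := perm_mem sr.
have sym (v : seq T) x y : v =i r -> x \in r -> x != y ->
    before v y x = ~~ before v x y.
  by move=> vE xr; apply: before_asym; rewrite vE.
rewrite reorder_signE // (perm_big r tr) /=.
transitivity (\big[addb/false]_(x <- r) \big[addb/false]_(y <- r)
    (before t x y && (before s x y (+) before t x y))).
  apply: eq_big_seq => x xr; rewrite (perm_big r tr) /=.
  apply: eq_big_seq => y yr; case: (boolP (before t x y)) => //= xy.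
  rewrite addbT sym //.
  by apply: contraTneq xy => ->; rewrite /before ltnn.
(* Changing the enumerating order from [t] to [r] adds a term that is symmetric in [x] and [y],
   hence of total 0. *)
apply: addb_eq0; rewrite -big_split /=.
under eq_bigr do rewrite -big_split /=.
apply: big_addb_sym => [x y xr yr|x xr]; last by rewrite /before !ltnn.
have [->//|xy] := eqVneq x y.
rewrite !(sym _ x y) //.
by case: (before t x y) (before s x y) (before r x y) => [] [] [].
Qed.

Lemma reorder_sign_trans T (s t u : seq T) : uniq s -> perm_eq s t -> perm_eq t u ->
  reorder_sign s u = reorder_sign s t (+) reorder_sign t u.
Proof.
move=> us st tu; have ts : perm_eq t s by rewrite perm_sym.
have us' : perm_eq u s by rewrite perm_sym (perm_trans st).
rewrite !(reorder_sign_pairs us) // -big_split; apply: eq_bigr => x _.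
rewrite -big_split; apply: eq_bigr => y _ /=.
by case: (before s x y) (before t x y) (before u x y) => [] [] [].
Qed.

Lemma reorder_sign_sym T (s t : seq T) : uniq s -> perm_eq s t ->
  reorder_sign t s = reorder_sign s t.
Proof.
move=> us st; have ts : perm_eq t s by rewrite perm_sym.
have := reorder_sign_trans us st ts.
by rewrite reorder_sign_refl // => /esym/addb_eq0.
Qed.

(** Bringing [f] to the front of a word costs as many transpositions as its index, and a common
    first letter costs nothing. This measures the effect on a sign of removing one odd letter, see
    [koszul_flip]. *)
Lemma reorder_sign_front T (f : T) (s t : seq T) : uniq s -> perm_eq s t -> f \in s ->
  reorder_sign s t =
    reorder_sign (rem f s) (rem f t) (+) odd (index f s) (+) odd (index f t).
Proof.
have front v : uniq v -> f \in v -> reorder_sign v (f :: rem f v) = odd (index f v).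
  move=> uv fv; case/splitPr: v / fv uv => a c uv.
  have fa : f \notin a.
    by move: uv; rewrite cat_uniq => /and3P[_ /hasPn/(_ f)]; rewrite mem_head => /(_ isT).
  have -> : rem f (a ++ f :: c) = a ++ c.
    elim: a fa {uv} => /= [|x a IHa]; first by rewrite eqxx.
    by rewrite inE negb_or eq_sym => /andP[/negPf-> /IHa->].
  rewrite index_cat (negPf fa) /= eqxx addn0.
  rewrite -[f :: c]cat1s catA -[f :: a ++ c]cat1s catA reorder_sign_cat //; first last.
  - by rewrite perm_catC.
  - by rewrite -catA.
  have uc : uniq c by move: uv; rewrite cat_uniq => /and3P[_ _ /andP[]].
  rewrite (reorder_sign_refl uc) addbF reorder_sign_swap ?andbT //.
  by move: uv; rewrite -[f :: c]cat1s catA cat_uniq => /and3P[].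
move=> us st fs; have ft : f \in t by rewrite -(perm_mem st).
have ut : uniq t by rewrite -(perm_uniq st).
have sR := perm_to_rem fs; have tR := perm_to_rem ft.
have rR : perm_eq (rem f s) (rem f t).
  by rewrite -(perm_cons f) -(permPl sR) (perm_trans st).
rewrite (reorder_sign_trans us sR); last by rewrite -(permPl sR).
rewrite (@reorder_sign_trans _ (f :: rem f s) (f :: rem f t)) ?perm_cons //; first last.
- by rewrite perm_sym.
- by rewrite -(perm_uniq sR).
rewrite -[f :: rem f s]cat1s -[f :: rem f t]cat1s reorder_sign_cat //; last first.
  by rewrite cat1s -(perm_uniq sR).
rewrite (@reorder_sign_refl _ [:: f]) // cat1s (reorder_sign_sym ut tR) !front //.
by rewrite addFb addbCA addbA.
Qed.

End ReorderSign.

(** * Koszul signs and permutations of blocks *)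

Section Koszul.

Variables (T : eqType) (p : pred T).
Implicit Types s t u : seq T.

(* Sign of the rearrangement of s into t when the letters satisfying p are odd. *)
Definition koszul s t := reorder_sign (filter p s) (filter p t).

Lemma koszul_refl s : uniq s -> koszul s s = false.
Proof. by move=> us; rewrite /koszul reorder_sign_refl // filter_uniq. Qed.

Lemma koszul_trans s t u : uniq s -> perm_eq s t -> perm_eq t u ->
  koszul s u = koszul s t (+) koszul t u.
Proof.
by move=> us st tu; apply: reorder_sign_trans; rewrite ?filter_uniq ?perm_filter.
Qed.

Lemma koszul_cat s s' t t' : uniq (s ++ t) -> perm_eq s s' -> perm_eq t t' ->
  koszul (s ++ t) (s' ++ t') = koszul s s' (+) koszul t t'.
Proof.
move=> ust ss' tt'; rewrite /koszul !filter_cat.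
by apply: reorder_sign_cat; rewrite -?filter_cat ?filter_uniq ?perm_filter.
Qed.

Lemma koszul_swap s t : uniq (s ++ t) ->
  koszul (s ++ t) (t ++ s) = odd (count p s) && odd (count p t).
Proof.
move=> ust; rewrite /koszul !filter_cat reorder_sign_swap ?size_filter //.
by rewrite -filter_cat filter_uniq.
Qed.

Lemma koszul_move s t u : uniq (s ++ t ++ u) ->
  koszul (s ++ t ++ u) (t ++ s ++ u) = odd (count p s) && odd (count p t).
Proof.
rewrite catA => us; rewrite [t ++ s ++ u]catA.
have := us; rewrite cat_uniq => /and3P[ust _ uu].
have stC : perm_eq (s ++ t) (t ++ s) by rewrite perm_catC.
by rewrite (koszul_cat us stC) // koszul_swap // koszul_refl // addbF.
Qed.

End Koszul.

Lemma koszul_map (T T' : eqType) (f : T -> T') (p : pred T') (s t : seq T) :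
  injective f -> koszul p (map f s) (map f t) = koszul (preim f p) s t.
Proof. by move=> injf; rewrite /koszul !filter_map reorder_sign_map. Qed.

Lemma eq_koszul (T : eqType) (p q : pred T) (s t : seq T) :
  p =1 q -> koszul p s t = koszul q s t.
Proof. by move=> pq; rewrite /koszul !(eq_filter pq). Qed.

Lemma koszul_predT (T : eqType) (s t : seq T) : koszul predT s t = reorder_sign s t.
Proof. by rewrite /koszul !filter_predT. Qed.

(* Two words, of tensor factors and of labels, are rearranged simultaneously;
   by [parity_F] the two signs of a transposition of blocks cancel wherever the
   product does not vanish. *)
Section Blocks.

Variables (k : fieldType) (E T L H : eqType).
Variables (w : E -> seq T) (l : E -> seq L) (p : pred T) (F : E -> k) (h : E -> H).

Hypothesis parity_F : forall e, F e != 0 -> odd (count p (w e)) = odd (size (l e)).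
Hypothesis same_h : forall e e', h e = h e' ->
  [/\ perm_eq (w e) (w e'), perm_eq (l e) (l e') &
      F e' = (-1) ^+ (koszul p (w e) (w e') (+) reorder_sign (l e) (l e')) * F e].

Let words s := flatten (map w s).
Let labels s := flatten (map l s).

Let parity_prod s : \prod_(e <- s) F e != 0 ->
  odd (count p (words s)) = odd (count predT (labels s)).
Proof.
elim: s => //= e s IHs; rewrite big_cons mulf_eq0 negb_or => /andP[/parity_F pe /IHs].
by rewrite !count_cat !oddD pe count_predT => ->.
Qed.

(** Induction on [s']: the block of [s] with the same value of [h] as the first block of [s'] is
    moved to the front and exchanged for it by [same_h]; the remaining blocks are handled by
    induction. *)
Lemma prod_blocks (s s' : seq E) :
  perm_eq (map h s) (map h s') -> uniq (words s) -> uniq (labels s) ->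
  [/\ perm_eq (words s) (words s'), perm_eq (labels s) (labels s') &
    \prod_(e <- s') F e =
      (-1) ^+ (koszul p (words s) (words s') (+) reorder_sign (labels s) (labels s'))
      * \prod_(e <- s) F e].
Proof.
elim: s' s => [|e' s' IHs'] s.
  move/perm_size; rewrite size_map => /size0nil-> _ _.
  by rewrite /words /labels /= !perm_refl !big_nil expr0 mul1r.
move=> ss'; have /mapP[e es he] : h e' \in map h s by rewrite (perm_mem ss') mem_head.
case/splitPr: s / es ss' => a c.
rewrite map_cat [map h (e :: c)]/= -cat1s perm_catCA /= -he perm_cons -map_cat => acs'.
have flat (X : eqType) (f : E -> seq X) b d :
  flatten (map f (b ++ d)) = flatten (map f b) ++ flatten (map f d).
  by rewrite map_cat flatten_cat.
rewrite {1}/words {1}/labels !flat /= -/(words a) -/(words c) -/(labels a) -/(labels c).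
move=> uw ul.
have [wee lee Fee] := same_h (esym he).
have uw' : uniq (w e ++ words a ++ words c) by rewrite uniq_catCA.
have ul' : uniq (l e ++ labels a ++ labels c) by rewrite uniq_catCA.
have [|| ] := IHs' _ acs'; rewrite /words /labels !flat.
- by move: uw'; rewrite cat_uniq => /and3P[].
- by move: ul'; rewrite cat_uniq => /and3P[].
rewrite -/(words a) -/(words c) -/(labels a) -/(labels c) -/(words s') -/(labels s').
move=> wI lI FI.
have pw : perm_eq (w e ++ words a ++ words c) (w e' ++ words s').
  by apply: perm_cat.
have pl : perm_eq (l e ++ labels a ++ labels c) (l e' ++ labels s').
  by apply: perm_cat.
split; first by rewrite perm_catCA.
  by rewrite perm_catCA.
have cw : perm_eq (words a ++ w e ++ words c) (w e ++ words a ++ words c).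
  by rewrite perm_catCA.
have cl : perm_eq (labels a ++ l e ++ labels c) (l e ++ labels a ++ labels c).
  by rewrite perm_catCA.
have kw := koszul_trans p uw cw pw.
rewrite (koszul_move _ uw) (koszul_cat _ uw' wee wI) in kw.
have kl := koszul_trans predT ul cl pl.
rewrite (koszul_move _ ul) (koszul_cat _ ul' lee lI) !koszul_predT !count_predT in kl.
rewrite kw kl big_cons big_cat big_cons /= Fee FI big_cat /=.
(* If no factor vanishes, then in both words the part [a] has one and the same parity, and so has
   the block [e]; moving [e] past [a] then gives the sign [x] twice. *)
have [->|nza] := eqVneq (\prod_(i <- a) F i) 0; first by rewrite !(mul0r, mulr0).
have [->|nze] := eqVneq (F e) 0; first by rewrite !(mul0r, mulr0).
rewrite -count_predT -(parity_prod nza) (parity_F nze).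
rewrite [(_ && _) (+) _]addbC.
set x := _ && _; move: (koszul p _ _) (koszul p _ _) (reorder_sign _ _) (reorder_sign _ _) x.
move=> x1 x2 y1 y2 x.
have -> : x2 (+) x1 (+) x (+) (x (+) (y2 (+) y1)) = (x2 (+) y2) (+) (x1 (+) y1).
  by case: x x1 x2 y1 y2 => [] [] [] [] [].
by rewrite [in RHS]signr_addb -!mulrA; congr (_ * _); rewrite mulrCA;
   congr (_ * _); rewrite mulrCA.
Qed.

End Blocks.

(** * The coefficients of g^-1_It and g^-1 *)

Section DualBasis.

Variables (k : fieldType) (A : super_data k) (b : homog_basis A).

Local Notation N := (bdim b).
Local Notation e := (tnth (bvec b)).
Local Notation p := (@bpar k A b).

Lemma linfunE (U V : vectType k) (f : U -> V) : linear f -> linfun f =1 f.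
Proof.
move=> linf; pose F : {linear U -> V} := HB.pack f (GRing.isLinear.Build _ _ _ _ f linf).
exact: (lfunE F).
Qed.

Lemma formPE a x : formP A a x = form A a x.
Proof.
have formE u y : linfun (form A u : A -> k^o) y = form A u y.
  exact: (lfunE (form A u : {linear A -> k^o})).
rewrite linfunE ?formE // => c u v.
by apply/lfunP => y; rewrite add_lfunE scale_lfunE !formE linearPl.
Qed.

Lemma lker_formP : lker (formP A) == 0%VS.
Proof.
apply/lker0P => u v eq_uv; apply/eqP; rewrite -subr_eq0; apply/eqP.
by apply: form_nondeg => x; rewrite linearBl /= -!formPE eq_uv subrr.
Qed.

Lemma formPVK phi : formP A ((formP A)^-1%VF phi) = phi.
Proof.
apply: limg_lfunVK; suff -> : limg (formP A) = fullv by exact: memvf.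
apply/eqP; rewrite eqEdim subvf /= limg_dim_eq; last by rewrite (eqP lker_formP) capv0.
by rewrite !dimvf /dim /= muln1.
Qed.

(* P^-1 e^i *)
Definition dualb (i : 'I_N) : A := (formP A)^-1%VF (dual_vec i).

Lemma form_dualb i x : form A (dualb i) x = coord (bvec b) i x.
Proof. by rewrite -formPE formPVK lfunE. Qed.

Lemma coord_e i j : coord (bvec b) i (e j) = (i == j)%:R.
Proof.
by rewrite (tnth_nth 0) coord_free ?(basis_free (bvecP b)) // eq_sym.
Qed.

Lemma coord_sum v : v = \sum_i coord (bvec b) i v *: e i.
Proof.
rewrite [LHS](coord_basis (bvecP b)) ?memvf //.
by apply: eq_bigr => i _; rewrite (tnth_nth 0).
Qed.

Lemma form_eq0 u v s t : u \in part A s -> v \in part A t -> form A u v != 0 -> s (+) t.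
Proof.
move=> us vt; apply: contraNT; rewrite -negb_eqb negbK => /eqP st.
by rewrite (form_odd us) // st.
Qed.

Lemma part_split v : exists v0 v1, [/\ v = v0 + v1, v0 \in part A false & v1 \in part A true].
Proof.
have: v \in (part A false + part A true)%VS by rewrite part_full memvf.
by case/memv_addP => v0 V0 [v1 V1 ->]; exists v0, v1.
Qed.

Lemma form_basis_eq0 v : (forall i, form A v (e i) = 0) -> v = 0.
Proof.
move=> ve0; apply: form_nondeg => x; rewrite [x]coord_sum linear_sumr big1 // => i _.
by rewrite linearZr_LR ve0 /= mulr0.
Qed.

(** An odd form pairs opposite parities. The component of parity [p i] kills the basis vectors of
    parity [p i] by oddness. On a vector e_j of the other parity it agrees with e^i, which vanishes
    there because j differs from i. *)
Lemma dualb_part i : dualb i \in part A (~~ p i).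
Proof.
have [v0 [v1 [uE V0 V1]]] := part_split (dualb i).
pose w s := if s then v1 else v0.
have W s : w s \in part A s by case: s.
suff w0 : w (p i) = 0.
  suff -> : dualb i = w (~~ p i) by apply: W.
  by rewrite uE; move: w0; case: (p i) => /= ->; rewrite ?addr0 ?add0r.
apply: form_basis_eq0 => j.
have [pji|] := eqVneq (p j) (p i).
  by apply: form_odd (W _) _; rewrite -pji bparP.
move=> pji; have pj : p j = ~~ p i by move: pji; case: (p j) (p i) => [] [].
have : form A (dualb i) (e j) = 0.
  rewrite form_dualb coord_e; case: eqP => // eij.
  by rewrite eij eqxx in pji.
rewrite uE linearDl /= -/(w true) -/(w false).
have wj : form A (w (~~ p i)) (e j) = 0.
  by apply: form_odd (W _) _; rewrite -pj bparP.
by move: wj; case: (p i) => /= ->; rewrite ?add0r ?addr0.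
Qed.

Let pparE (i : 'I_N) : ppar i = ~~ p i.
Proof. by []. Qed.

(** Under the isomorphism given by the form, the dual operator becomes the original one: the sign in
    [opIt_dual] is the sign by which the form moves the operator from one argument to the other. *)
Lemma prop_coefE (i j : 'I_N) :
  prop_coef i j = (-1) ^+ (ppar i && ppar j) * form A (opIt A (dualb i)) (dualb j).
Proof.
rewrite /prop_coef /form_inverse_It /form_inverse -/(dualb j); congr (_ * form A _ _).
suff -> : opIt_dual (ppar i) (dual_vec i) = formP A (opIt A (dualb i)).
  by rewrite lker0_lfunK ?lker_formP.
apply/lfunP => x; rewrite formPE (opIt_form _ (dualb_part i)) form_dualb.
rewrite linfunE ?lfunE // => c u v.
by rewrite !linearP /= mulrDr mulrCA.
Qed.

Lemma prop_coef_even (i j : 'I_N) : prop_coef i j != 0 -> ppar i = ppar j.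
Proof.
rewrite prop_coefE mulf_eq0 signr_eq0 /= => /(form_eq0 (opIt_odd (dualb_part i)) (dualb_part j)).
by rewrite !pparE negbK; case: (p i) (p j) => [] [].
Qed.

Lemma prop_coef_sym (i j : 'I_N) : prop_coef i j = (-1) ^+ (ppar i && ppar j) * prop_coef j i.
Proof.
rewrite !prop_coefE (opIt_form _ (dualb_part i)).
rewrite (form_sym (dualb_part i) (opIt_odd (dualb_part j))) !pparE.
by case: (p i) (p j) => [] [] /=; rewrite ?(expr0, expr1, mul1r, mulN1r, opprK).
Qed.

(** The coefficients of the bivector g^-1. Compared with [prop_coef] the sign (-1)^(ppar i && ppar
    j) is absent: g^-1 is odd, so exactly one of the two indices is odd where the coefficient is
    nonzero. *)
Definition inv_coef (i j : 'I_N) : k := form A (dualb i) (dualb j).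

Lemma inv_coef_odd (i j : 'I_N) : inv_coef i j != 0 -> ppar i (+) ppar j.
Proof. exact: form_eq0 (dualb_part i) (dualb_part j). Qed.

Lemma inv_coef_sym (i j : 'I_N) : inv_coef i j = inv_coef j i.
Proof.
have [c0|] := eqVneq (inv_coef i j) 0.
  move: c0; rewrite /inv_coef (form_sym (dualb_part i) (dualb_part j)) => /eqP.
  by rewrite mulf_eq0 signr_eq0 => /eqP->; rewrite mulr0.
move/inv_coef_odd; rewrite /inv_coef (form_sym (dualb_part i) (dualb_part j)) !pparE.
by case: (p i) (p j) => [] [] //= _; rewrite mul1r.
Qed.

Lemma coord_part i s v : v \in part A s -> coord (bvec b) i v != 0 -> p i = s.
Proof.
move=> vs; rewrite -form_dualb => /(form_eq0 (dualb_part i) vs).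
by case: (p i) s {vs} => [] [].
Qed.

(** The transpose of I on the dual basis; it is I up to sign because I is skew for the form. *)
Lemma sum_coord_opI (a : 'I_N) :
  \sum_i coord (bvec b) a (opI A (e i)) *: dualb i = - (-1) ^+ ppar a *: opI A (dualb a).
Proof.
apply/eqP; rewrite -subr_eq0; apply/eqP; apply: form_basis_eq0 => j.
rewrite linearBl linear_sumlz /= (bigD1 j) //= big1 => [|i ij]; last first.
  by rewrite linearZl_LR /= form_dualb coord_e (negPf ij) mulr0.
rewrite !linearZl_LR /= form_dualb coord_e eqxx mulr1 addr0 -form_dualb.
have /eqP := opI_form (e j) (dualb_part a); rewrite addr_eq0 => /eqP->.
by rewrite mulNr mulrN opprK mulrA -signr_addb addbb mul1r subrr.
Qed.

(** With u_a = P^-1 e^a, acting on the first factor produces g(It I u_a, u_c), and acting on the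
    second produces g(I It u_a, u_c) once I is moved across the form. The two add up by [I, It] =
    1. *)
Lemma opI_prop_coef (a c : 'I_N) :
  \sum_i coord (bvec b) a (opI A (e i)) * prop_coef i c +
    (-1) ^+ ppar a * \sum_i coord (bvec b) c (opI A (e i)) * prop_coef a i =
  inv_coef a c.
Proof.
rewrite /inv_coef -[in RHS](opI_opIt (dualb a)) linearDl /= addrC; congr (_ + _).
  rewrite mulr_sumr (eq_bigr (fun i => coord (bvec b) c (opI A (e i)) *
      form A (opIt A (dualb a)) (dualb i))) => [|i _]; last first.
    rewrite mulrCA; congr (_ * _).
    have [p0|/prop_coef_even pai] := eqVneq (prop_coef a i) 0.
      move/eqP: p0 (p0); rewrite {1}prop_coefE mulf_eq0 signr_eq0 => /eqP-> ->.
      by rewrite mulr0.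
    by rewrite prop_coefE -pai andbb mulrA -signr_addb addbb mul1r.
  have := congr1 (form A (opIt A (dualb a))) (sum_coord_opI c).
  rewrite linear_sumr linearZr_LR /=.
  under eq_bigr do rewrite linearZr_LR /=.
  move=> ->; have ItV := opIt_odd (dualb_part a).
  have /eqP := opI_form (dualb c) ItV; rewrite addr_eq0 => /eqP->.
  have [->|] := eqVneq (form A (opIt A (dualb a)) (opI A (dualb c))) 0.
    by rewrite !mulr0 oppr0.
  move/(form_eq0 ItV (opI_odd (dualb_part c))); rewrite !negbK mulNr !pparE.
  by case: (p a) (p c) => [] [].
rewrite (eq_bigr (fun i => (-1) ^+ p a * (coord (bvec b) a (opI A (e i)) *
    form A (opIt A (dualb i)) (dualb c)))) => [|i _]; last first.
  have [->|ai] := eqVneq (coord (bvec b) a (opI A (e i))) 0.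
    by rewrite !mul0r mulr0.
  suff -> : prop_coef i c = (-1) ^+ p a * form A (opIt A (dualb i)) (dualb c).
    by rewrite mulrCA.
  have pai := coord_part (opI_odd (bparP i)) ai.
  have [p0|/prop_coef_even pic] := eqVneq (prop_coef i c) 0.
    move/eqP: p0 (p0); rewrite {1}prop_coefE mulf_eq0 signr_eq0 => /eqP-> ->.
    by rewrite mulr0.
  by rewrite prop_coefE -pic andbb pai.
rewrite -mulr_sumr.
have := congr1 (fun v => form A (opIt A v) (dualb c)) (sum_coord_opI a).
rewrite linear_sum linear_sumlz linearZ linearZl_LR /=.
under eq_bigr do rewrite linearZ linearZl_LR /=.
move=> ->; rewrite mulrA !pparE.
by case: (p a); rewrite ?(expr1, expr0, mulrN, mulNr, mul1r, opprK, mulr1).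
Qed.

End DualBasis.

(** * The cyclic tensors alpha_n *)

Lemma cat_cons_neq0 (T : eqType) (s t : seq T) x : s ++ x :: t != [::].
Proof. by case: s. Qed.

Section CyclicProduct.

Variables (k : fieldType) (A : super_data k).
Implicit Types (x y z : A) (s t : seq A).

Definition mulseq s : A := foldl (mul A) (head 0 s) (behead s).

(** The unsigned part of [alpha]. Since [behead s] has [size s - 1] entries, taking [size s - 2] of
    them leaves out only the last. *)
Definition cyc_form s : k :=
  form A (foldl (mul A) (head 0 s) (take (size s - 2) (behead s))) (last 0 s).

Lemma mulseq_cat s t : s != [::] -> t != [::] ->
  mulseq (s ++ t) = mul A (mulseq s) (mulseq t).
Proof.
case: s t => // x s [|y t] // _ _; rewrite /mulseq /= foldl_cat /=.
elim/last_ind: t => [|t z IHt] //.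
by rewrite -!cats1 !foldl_cat /= IHt mul_assoc.
Qed.

(** Invariance of the form allows the product to be cut at any place; both cyclic symmetry and
    gluing come from this freedom. *)
Lemma cyc_form_cat s t : s != [::] -> t != [::] ->
  cyc_form (s ++ t) = form A (mulseq s) (mulseq t).
Proof.
have snoc (u : seq A) z : u != [::] -> cyc_form (rcons u z) = form A (mulseq u) z.
  case: u => // x u _; rewrite /cyc_form /= last_rcons size_rcons subn2 /=.
  by rewrite -cats1 take_size_cat.
case/lastP: t => // t z s0 _; rewrite -rcons_cat snoc; last by case: s s0.
case: (eqVneq t [::]) => [->|t0]; first by rewrite cats0.
by rewrite -cats1 !mulseq_cat // form_inv.
Qed.

(** The size condition excludes a one-letter word, where head and last letter coincide and
    [cyc_form] is quadratic. *)
Lemma cyc_form_slot (I : finType) (c : I -> k) (v : I -> A) s t :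
  (0 < size s + size t)%N ->
  cyc_form (s ++ (\sum_i c i *: v i) :: t) = \sum_i c i * cyc_form (s ++ v i :: t).
Proof.
case: (eqVneq s [::]) => [->|s0].
  case: (eqVneq t [::]) => [->|t0] // _; rewrite /= -cat1s cyc_form_cat //.
  rewrite linear_sumlz; apply: eq_bigr => i _.
  by rewrite linearZl_LR -[v i :: t]cat1s cyc_form_cat.
move=> _; have [->|t0] := eqVneq t [::].
  rewrite cyc_form_cat // linear_sumr; apply: eq_bigr => i _.
  by rewrite linearZr_LR cyc_form_cat.
rewrite cyc_form_cat // -cat1s mulseq_cat // linear_sumlz linear_sumr.
apply: eq_bigr => i _.
by rewrite linearZl_LR linearZr_LR cyc_form_cat // -[v i :: t]cat1s mulseq_cat.
Qed.

End CyclicProduct.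

(* The parity of \sum_j (n - j) a_j, which is the exponent in alpha_n with the
   double sum exchanged. *)
Fixpoint shift_exp (s : seq bool) : bool :=
  if s is q :: s' then (q && odd (size s')) (+) shift_exp s' else false.

Lemma shift_exp_cat s t :
  shift_exp (s ++ t) = shift_exp s (+) (odd (count id s) && odd (size t)) (+) shift_exp t.
Proof.
elim: s => //= q s ->; rewrite size_cat !oddD oddb.
by case: q (odd (size s)) (odd (size t)) (odd (count _ s)) (shift_exp s) (shift_exp t)
   => [] [] [] [] [] [].
Qed.

Lemma odd_shift_exp s :
  odd (\sum_(1 <= i < size s) \sum_(0 <= j < i) nth false s j) = shift_exp s.
Proof.
elim: s => [|q s IHs]; first by rewrite big_geq.
rewrite -[size _]/(size s).+1 big_add1 /=.
rewrite (eq_bigr (fun i => q + \sum_(0 <= j < i) nth false s j)%N); last first.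
  by move=> i _; rewrite big_nat_recl.
rewrite big_split /= sum_nat_const_nat subn0 oddD oddM oddb andbC -IHs.
congr (_ (+) odd _); case: (size s) => [|n]; first by rewrite !big_geq.
by rewrite big_nat_recl // big_geq // add0n big_add1.
Qed.

Section Alpha.

Variables (k : fieldType) (A : super_data k) (b : homog_basis A).

Local Notation N := (bdim b).
Local Notation e := (tnth (bvec b)).
Local Notation p := (@bpar k A b).
Implicit Types s t : seq 'I_N.

Lemma alphaE s : alpha s = (-1) ^+ shift_exp (map p s) * cyc_form (map e s).
Proof.
by rewrite /alpha /cyc_form size_map -odd_shift_exp size_map signr_odd.
Qed.

Lemma count_ppar s : odd (count (@ppar k A b) s) = odd (count p s) (+) odd (size s).
Proof.
rewrite -(count_predC p s) oddD addKb; congr odd; exact: eq_count.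
Qed.

Lemma mulseq_part s : s != [::] -> mulseq (map e s) \in part A (odd (count p s)).
Proof.
elim/last_ind: s => // s i IHs _; have [->|s0] := eqVneq s [::].
  by rewrite /= addn0 oddb; apply: bparP.
rewrite map_rcons -cats1 mulseq_cat //; last by case: s s0 {IHs}.
by rewrite -cats1 count_cat /= addn0 oddD oddb; apply: mul_graded; [exact: IHs|exact: bparP].
Qed.

(** The product is even and the form is odd. With [count_ppar] this gives n + 1 modulo 2 odd
    arguments in Pi A. *)
Lemma alpha_parity s : (2 <= size s)%N -> alpha s != 0 -> odd (count p s).
Proof.
rewrite alphaE mulf_eq0 signr_eq0 /=.
case/lastP: s => // s i; rewrite size_rcons ltnS => s_gt0.
have s0 : s != [::] by case: s s_gt0.
rewrite map_rcons -cats1 cyc_form_cat //; last by case: s s0 {s_gt0}.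
move/(form_eq0 (mulseq_part s0) (bparP i)).
by rewrite -cats1 count_cat /= addn0 oddD oddb.
Qed.

(** The first summand of the exponent is the Koszul sign of moving [i] past [s]; the second,
    [odd (size s)], is the sign of the same rotation of the flags in the orientation word. *)
Lemma alpha_rot i s : s != [::] ->
  alpha (rcons s i) =
    (-1) ^+ ((ppar i && odd (count (@ppar k A b) s)) (+) odd (size s)) * alpha (i :: s).
Proof.
move=> s0; have ms0 : map e s != [::] by case: s s0.
rewrite !alphaE -cats1 !map_cat /= -[e i :: map e s]cat1s !cyc_form_cat //.
rewrite [mulseq [:: e i]]/(e i).
rewrite (form_sym (mulseq_part s0) (bparP i)).
have [->|] := eqVneq (form A (e i) (mulseq (map e s))) 0; first by rewrite !mulr0.
move/(form_eq0 (bparP i) (mulseq_part s0)) => par.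
rewrite !mulrA; congr (_ * _); rewrite -!signr_addb; congr (_ ^+ nat_of_bool _).
rewrite shift_exp_cat /= count_ppar count_map size_map /ppar.
have -> : count (preim p id) s = count p s by [].
by move: par; case: (p i) (odd (count p s)) (odd (size s)) (shift_exp _) => [] [] [] [].
Qed.

Lemma mulseq_opI (x0 : 'I_N) s : s != [::] ->
  opI A (mulseq (map e s)) =
    \sum_(0 <= n < size s) (-1) ^+ odd (count p (take n s)) *:
      mulseq (map e (take n s) ++ opI A (e (nth x0 s n)) :: map e (drop n.+1 s)).
Proof.
elim/last_ind: s => // s i IHs _; have [->|s0] := eqVneq s [::].
  by rewrite big_nat1 /= scale1r.
have ms0 : map e s != [::] by case: s s0 {IHs}.
rewrite map_rcons size_rcons big_nat_recr //= nth_rcons ltnn eqxx.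
rewrite -!cats1 take_size_cat // mulseq_cat // drop_oversize ?size_cat ?addn1 //.
rewrite [map e [::]]/= mulseq_cat // (opI_der _ (mulseq_part s0)); congr (_ + _).
rewrite IHs // linear_sumlz; apply: eq_big_nat => n /andP[_ ltns].
rewrite linearZl_LR /= takel_cat ?(ltnW ltns) // nth_cat ltns drop_cat.
case: ltnP => [lt|ge].
  rewrite map_cat -cat_cons catA [in RHS]mulseq_cat //.
  exact: cat_cons_neq0.
have -> : n.+1 = size s by apply/eqP; rewrite eqn_leq ltns.
rewrite drop_size subnn drop0 -[_ :: map e [:: i]]/([:: _] ++ [:: e i]) catA.
rewrite [in RHS]mulseq_cat //.
exact: cat_cons_neq0.
Qed.

(** The Leibniz rule collects all terms but the last into I of the product of the first letters;
    skewness of I for the form cancels this against the last term. [x0] is only a default value for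
    [nth]. *)
Lemma cyc_form_opI (x0 : 'I_N) s : (2 <= size s)%N ->
  \sum_(0 <= n < size s) (-1) ^+ odd (count p (take n s)) *
    cyc_form (map e (take n s) ++ opI A (e (nth x0 s n)) :: map e (drop n.+1 s)) = 0.
Proof.
case/lastP: s => // s i; rewrite size_rcons ltnS => s_gt0.
have s0 : s != [::] by case: s s_gt0.
have ms0 : map e s != [::] by case: s s0 {s_gt0}.
rewrite big_nat_recr //= nth_rcons ltnn eqxx.
rewrite -!cats1 take_size_cat // drop_oversize ?size_cat ?addn1 // cyc_form_cat //.
have := opI_form (e i) (mulseq_part s0).
rewrite (mulseq_opI x0 s0) linear_sumlz => sumI; rewrite -[RHS]sumI; congr (_ + _).
apply: eq_big_nat => n /andP[_ ltns].
rewrite linearZl_LR /= takel_cat ?(ltnW ltns) // nth_cat ltns drop_cat.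
case: ltnP => [lt|ge].
  rewrite map_cat -cat_cons catA [in LHS]cyc_form_cat //.
  exact: cat_cons_neq0.
have -> : n.+1 = size s by apply/eqP; rewrite eqn_leq ltns.
rewrite drop_size subnn drop0 -[_ :: map e [:: i]]/([:: _] ++ [:: e i]) catA.
rewrite [in LHS]cyc_form_cat //.
exact: cat_cons_neq0.
Qed.

Lemma alpha_opI (x0 : 'I_N) s : (2 <= size s)%N ->
  \sum_(0 <= n < size s) (-1) ^+ odd (count (@ppar k A b) (take n s)) *
    \sum_i coord (bvec b) i (opI A (e (nth x0 s n))) *
      alpha (take n s ++ i :: drop n.+1 s) = 0.
Proof.
(* Changing the parity of the n-th letter changes [shift_exp] by the number of later letters, and
   passing from [p] to [ppar] contributes the number of earlier ones. Their sum [size s - 1] does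
   not depend on n, so all terms share the sign [x]. *)
move=> s2; pose x : k := (-1) ^+ (shift_exp (map p s) (+) ~~ odd (size s)).
apply: (etrans _ (mulr0 x)); apply: (etrans _ (congr1 ( *%R x) (cyc_form_opI x0 s2))).
rewrite [RHS]mulr_sumr; apply: eq_big_nat => n /andP[_ ltns].
have sE : s = take n s ++ nth x0 s n :: drop n.+1 s.
  by rewrite -[LHS](cat_take_drop n) (drop_nth x0).
set j := nth x0 s n in sE *; set l := take n s in sE *; set r := drop n.+1 s in sE *.
have sz : size s = (size l + size r).+1 by rewrite sE size_cat /= addnS.
rewrite [opI A (e j) in RHS](coord_sum b) cyc_form_slot; last first.
  by rewrite !size_map -ltnS -sz.
rewrite !mulr_sumr; apply: eq_bigr => i _.
have [->|nz] := eqVneq (coord (bvec b) i (opI A (e j))) 0; first by rewrite !(mul0r, mulr0).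
have pij := coord_part (opI_odd (bparP j)) nz.
rewrite alphaE !map_cat /= mulrCA [in RHS](mulrCA _ (coord _ _ _)) [RHS]mulrCA.
congr (_ * _); rewrite !mulrA; congr (_ * _).
rewrite /x -!signr_addb; congr (_ ^+ nat_of_bool _).
rewrite count_ppar sz sE !map_cat !shift_exp_cat /= pij !size_map oddD.
move: (shift_exp _) (shift_exp _) (odd (count id _)) (odd (count _ _)) => x1 x2 x3 x4.
by case: (p j) x1 x2 x3 x4 (odd (size l)) (odd (size r)) => [] [] [] [] [] [] [].
Qed.

(** Since dualb j = \sum_i inv_coef i j e_i, the sum over [i] gives the j-th coordinate of the
    product of [s], and the sum over [j] puts that product into the form with the product of [t].
    The sign is that of moving [j] past [s], from the order i j s t to i s j t. *)
Lemma alpha_inv_coef s t : s != [::] -> t != [::] ->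
  \sum_i \sum_j (-1) ^+ (ppar j && odd (count (@ppar k A b) s)) *
      inv_coef i j * (alpha (i :: s) * alpha (j :: t)) =
  alpha (s ++ t).
Proof.
move=> s0 t0; have ms0 : map e s != [::] by case: s s0.
have mt0 : map e t != [::] by case: t t0.
set x := (-1) ^+ (shift_exp (map p s) (+) (odd (count p s) && odd (size t)) (+)
  shift_exp (map p t)) : k.
transitivity (x * \sum_j \sum_i form A (dualb i) (dualb j) *
    (form A (e i) (mulseq (map e s)) * form A (e j) (mulseq (map e t)))).
  rewrite exchange_big mulr_sumr; apply: eq_bigr => j _.
  rewrite mulr_sumr; apply: eq_bigr => i _ /=.
  rewrite !alphaE /= -[e i :: _]cat1s -[e j :: _]cat1s !cyc_form_cat //.
  rewrite [mulseq [:: e i]]/(e i) [mulseq [:: e j]]/(e j) -/(inv_coef i j).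
  have [->|cij] := eqVneq (inv_coef i j) 0; first by rewrite !(mul0r, mulr0).
  have [->|fi] := eqVneq (form A (e i) (mulseq (map e s))) 0.
    by rewrite !(mul0r, mulr0).
  have [->|fj] := eqVneq (form A (e j) (mulseq (map e t))) 0.
    by rewrite !(mul0r, mulr0).
  rewrite (mulrACA _ (form A (e i) _)) -[LHS]mulrA [LHS]mulrCA [RHS]mulrCA; congr (_ * _).
  rewrite [LHS]mulrA; congr (_ * _).
  rewrite /x -!signr_addb; congr (_ ^+ nat_of_bool _).
  (* The three nonzero factors tie the parities of e_i and e_j to those of the two products; under
     these relations the signs agree. *)
  move: cij fi fj => /inv_coef_odd cij /(form_eq0 (bparP i) (mulseq_part s0)) fi.
  move/(form_eq0 (bparP j) (mulseq_part t0)) => fj.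
  rewrite count_ppar !size_map; move: cij fi fj; rewrite /ppar.
  move: (shift_exp _) (shift_exp _) (odd (count p s)) (odd (count p t)) => x1 x2 x3 x4.
  by case: (p i) (p j) x1 x2 x3 x4 (odd (size s)) (odd (size t))
    => [] [] [] [] [] [] [] [].
rewrite alphaE [map p _]map_cat shift_exp_cat size_map count_map -/x; congr (_ * _).
rewrite map_cat cyc_form_cat //.
transitivity (\sum_j coord (bvec b) j (mulseq (map e s)) * form A (e j) (mulseq (map e t))).
  apply: eq_bigr => j _.
  under eq_bigr do rewrite mulrA.
  rewrite -mulr_suml -form_dualb [dualb j in RHS](coord_sum b) linear_sumlz.
  by congr (_ * _); apply: eq_bigr => i _; rewrite linearZl_LR /= form_dualb.
rewrite [mulseq (map e s) in RHS](coord_sum b) linear_sumlz.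
by apply: eq_bigr => j _; rewrite linearZl_LR.
Qed.

End Alpha.

(** * Independence of the starting flags *)

Section Orbits.

Variables (T : finType) (s : {perm T}).
Implicit Types (x y : T) (r : seq T).

Definition orbit_seq x := traject s x #|porbit s x|.

(* r lists one element of each cycle of s. *)
Definition orbit_reps r := perm_eq (flatten (map orbit_seq r)) (enum T).

Lemma mem_orbit_seq x y : (y \in orbit_seq x) = (y \in porbit s x).
Proof. by rewrite porbit_traject. Qed.

Lemma orbit_seq_uniq x : uniq (orbit_seq x).
Proof. exact: uniq_traject_porbit. Qed.

Lemma orbit_seq_behead x : orbit_seq x = x :: behead (orbit_seq x).
Proof. by rewrite /orbit_seq; case: #|_| (card_porbit_neq0 s x). Qed.

Lemma porbit_step x : porbit s (s x) = porbit s x.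
Proof. by have := porbit_perm s 1 x; rewrite expg1. Qed.

Lemma orbit_seq_step x : orbit_seq (s x) = rcons (behead (orbit_seq x)) x.
Proof.
rewrite /orbit_seq porbit_step; have := iter_porbit s x.
case: #|_| (card_porbit_neq0 s x) => // n _ xn.
by rewrite [LHS]trajectSr -iterSr xn.
Qed.

Lemma card_porbit_iter n x : (0 < n)%N -> iter n s x = x -> uniq (traject s x n) ->
  #|porbit s x| = n.
Proof.
move=> n0 itn ut; rewrite -[RHS](size_traject s x) -(card_uniqP ut).
apply: eq_card => y; apply/porbitP/trajectP => [[i ->]|[i _ ->]]; last first.
  by exists i; rewrite permX.
exists (i %% n)%N; first by rewrite ltn_mod.
rewrite permX {1}(divn_eq i n) addnC iterD; congr (iter _ _ _).
by elim: (i %/ n)%N => // m IHm; rewrite mulSn iterD IHm itn.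
Qed.

Lemma orbit_reps_porbits r :
  orbit_reps r -> perm_eq (map (porbit s) r) (enum (porbits s)).
Proof.
move=> rr; apply: uniq_perm; rewrite ?enum_uniq //.
  have: uniq (flatten (map orbit_seq r)) by rewrite (perm_uniq rr) enum_uniq.
  elim: r {rr} => //= x r IHr; rewrite cat_uniq => /and3P[_ /hasPn xr /IHr->].
  rewrite andbT; apply/mapP => -[y yr xy].
  have /xr : x \in flatten (map orbit_seq r).
    by apply/flatten_mapP; exists y; rewrite // mem_orbit_seq -xy porbit_id.
  by rewrite /= mem_orbit_seq porbit_id.
move=> v; rewrite mem_enum; apply/mapP/imsetP => [[x _ ->]|[x _ ->]]; first by exists x.
have: x \in flatten (map orbit_seq r) by rewrite (perm_mem rr) mem_enum.
case/flatten_mapP => y yr; rewrite mem_orbit_seq => xy; exists y => //.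
by apply/eqP; rewrite eq_porbit_mem.
Qed.

Lemma porbits_orbit_reps r :
  perm_eq (map (porbit s) r) (enum (porbits s)) -> orbit_reps r.
Proof.
move=> rr; apply: uniq_perm; rewrite ?enum_uniq //.
  have: uniq (map (porbit s) r) by rewrite (perm_uniq rr) enum_uniq.
  elim: r {rr} => //= x r IHr /andP[xr /IHr ur].
  rewrite cat_uniq ur orbit_seq_uniq andbT; apply/hasPn => y.
  case/flatten_mapP => z zr; rewrite /= !mem_orbit_seq => yz; apply: contra xr => yx.
  apply/mapP; exists z => //; transitivity (porbit s y); apply/eqP.
    by rewrite eq_sym eq_porbit_mem.
  by rewrite eq_porbit_mem.
move=> x; rewrite mem_enum; apply/flatten_mapP.
have: porbit s x \in map (porbit s) r by rewrite (perm_mem rr) mem_enum imset_f.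
by case/mapP => y yr xy; exists y; rewrite // mem_orbit_seq -xy porbit_id.
Qed.

End Orbits.

(** The rule relating a factor to its two words composes, so for a vertex it need only be checked
    for one step of [sigma]. *)
Lemma sign_block_trans (k : fieldType) (T L : eqType) (p : pred T)
    (w w' w'' : seq T) (l l' l'' : seq L) (F F' F'' : k) :
  uniq w -> uniq l -> perm_eq w w' -> perm_eq w' w'' -> perm_eq l l' -> perm_eq l' l'' ->
  F' = (-1) ^+ (koszul p w w' (+) reorder_sign l l') * F ->
  F'' = (-1) ^+ (koszul p w' w'' (+) reorder_sign l' l'') * F' ->
  F'' = (-1) ^+ (koszul p w w'' (+) reorder_sign l l'') * F.
Proof.
move=> uw ul ww' ww'' ll' ll'' -> ->.
rewrite (koszul_trans _ uw ww' ww'') (reorder_sign_trans ul ll' ll'') mulrA -signr_addb.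
by congr (_ ^+ nat_of_bool _ * _);
  case: (koszul p w w') (koszul p w' w'') (reorder_sign l l') => [] [] [];
  case: (reorder_sign _ _).
Qed.

Section Frames.

Variable G : ribbon_graph.

Definition vertex_word (f : flag G) : seq (letter G) :=
  inr (porbit (sigma G) f) :: map inl (vertex_flags f).

Lemma frame_wordE r : frame_word r = flatten (map vertex_word r).
Proof. by []. Qed.

Lemma vertex_word_uniq f : uniq (vertex_word f).
Proof.
rewrite /= map_inj_uniq ?orbit_seq_uniq ?andbT; last by move=> x y [].
by apply/mapP => -[].
Qed.

Lemma frame_word_orientation r : orbit_reps (sigma G) r -> is_orientation (frame_word r).
Proof.
move=> rr; rewrite /is_orientation /letters.
have sep : perm_eq (frame_word r)
    (map inl (flatten (map (orbit_seq (sigma G)) r)) ++ map inr (map (porbit (sigma G)) r)).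
  elim: r {rr} => //= f r IHr; rewrite map_cat -catA /=.
  apply: (perm_trans (perm_cat (perm_refl (vertex_word f)) IHr)).
  rewrite /= -[vertex_flags f]/(orbit_seq (sigma G) f) perm_sym.
  rewrite catA -[inr _ :: map _ _]cat1s -[inr _ :: _ ++ _]cat1s [X in perm_eq _ (_ ++ X)]catA.
  by rewrite perm_catCA.
apply: (perm_trans sep); apply: perm_cat; first exact: perm_map.
by apply: perm_map; apply: orbit_reps_porbits.
Qed.

Lemma letters_uniq : uniq (letters G).
Proof.
rewrite /letters cat_uniq; apply/and3P; split.
- by rewrite map_inj_uniq ?enum_uniq // => x y [].
- by apply/hasPn => _ /mapP[v _ ->]; apply/mapP => -[].
- by rewrite map_inj_uniq ?enum_uniq // => x y [].
Qed.

Lemma orientation_uniq (w : seq (letter G)) : is_orientation w -> uniq w.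
Proof. by move=> ww; rewrite (perm_uniq ww) letters_uniq. Qed.

Lemma frame_reps (w : seq (letter G)) : is_orientation w -> orbit_reps (sigma G) (frame w).
Proof.
move=> ww; apply: porbits_orbit_reps; rewrite /frame.
set flags := pmap _ w; set verts := pmap _ w.
have vertsE : perm_eq verts (enum (vertices G)).
  rewrite /verts; apply: (perm_trans (perm_pmap _ ww)).
  rewrite /letters pmap_cat.
  have -> : pmap (fun a : letter G => if a is inr v then Some v else None)
      [seq inl f | f <- enum (flag G)] = [::] by elim: (enum _).
  have -> : pmap (fun a : letter G => if a is inr v then Some v else None)
      [seq inr v | v <- enum (vertices G)] = enum (vertices G).
    by elim: (enum _) => //= v r ->.
  exact: perm_refl.
have flagsP f : f \in flags.
  by rewrite mem_pmap; apply/mapP; exists (inl f); rewrite // (perm_mem ww) mem_cat map_f ?mem_enum.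
apply: (perm_trans _ vertsE); rewrite (_ : map _ _ = verts) //.
have : {subset verts <= vertices G} by move=> v; rewrite (perm_mem vertsE) mem_enum.
elim: verts {vertsE} => //= v r IHr sub.
have /imsetP[x _ vE] : v \in vertices G by rewrite sub ?mem_head.
(* Some flag of the word lies in [v], so [ohead] returns a flag and [pmap] loses no vertex. *)
have : x \in [seq f <- flags | f \in v] by rewrite mem_filter flagsP vE porbit_id.
have : all (mem v) [seq f <- flags | f \in v] by rewrite filter_all.
case: [seq f <- flags | f \in v] => //= f _ /andP[fv _] _.
rewrite IHr => [|u ur]; last by rewrite sub // inE ur orbT.
by congr (_ :: _); apply/eqP; rewrite vE eq_porbit_mem -vE.
Qed.

Variables (k : fieldType) (A : super_data k) (b : homog_basis A).
Variable x : flag G -> 'I_(bdim b).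

Local Notation p := (fun f => ppar (x f)).

Let F (f : flag G) := alpha [seq x h | h <- vertex_flags f].

Let vertex_flagsE (f : flag G) : vertex_flags f = orbit_seq (sigma G) f.
Proof. by []. Qed.

Let size_vertex (f : flag G) : (3 <= size (vertex_flags f))%N.
Proof. by rewrite size_traject sigma_ge3. Qed.

Lemma vertex_parity (f : flag G) : F f != 0 ->
  odd (count p (vertex_flags f)) = odd (size (vertex_word f)).
Proof.
move/alpha_parity; rewrite size_map => /(_ (ltnW (size_vertex f))) par.
by have := count_ppar [seq x h | h <- vertex_flags f]; rewrite par count_map /= !size_map.
Qed.

(** The vertex letter stays in front and [f] moves to the end in both words; the two signs are those
    of [alpha_rot]. *)
Let same_vertex_step (f : flag G) :
  [/\ perm_eq (vertex_flags f) (vertex_flags (sigma G f)),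
      perm_eq (vertex_word f) (vertex_word (sigma G f)) &
      F (sigma G f) = (-1) ^+ (koszul p (vertex_flags f) (vertex_flags (sigma G f)) (+)
         reorder_sign (vertex_word f) (vertex_word (sigma G f))) * F f].
Proof.
have := vertex_word_uniq f; rewrite /F /vertex_word porbit_step.
rewrite !vertex_flagsE orbit_seq_step.
have : (2 <= size (behead (orbit_seq (sigma G) f)))%N.
  by have := size_vertex f; rewrite vertex_flagsE; case: (orbit_seq _ _).
have := orbit_seq_uniq (sigma G) f; rewrite (orbit_seq_behead _ f) /=.
move: (behead _) => t ut st uw.
have t0 : t != [::] by case: t st {ut uw}.
split; first by rewrite perm_sym perm_rcons.
  by rewrite perm_cons map_rcons perm_sym perm_rcons.
rewrite map_rcons alpha_rot; last by case: t t0 {ut uw st}.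
congr (_ ^+ nat_of_bool _ * _).
rewrite -cats1 -cat1s koszul_swap // map_cat /=.
rewrite -[inr _ :: inl _ :: _]cat1s -[inr _ :: _ ++ _]cat1s.
rewrite reorder_sign_cat //; last by rewrite -cat1s perm_catC.
rewrite (reorder_sign_refl (s := [:: inr _])) // -[inl f :: _]cat1s reorder_sign_swap.
  by rewrite /= addn0 oddb count_map !size_map.
by case/andP: uw.
Qed.

Let same_vertex (f g : flag G) : porbit (sigma G) f = porbit (sigma G) g ->
  [/\ perm_eq (vertex_flags f) (vertex_flags g),
      perm_eq (vertex_word f) (vertex_word g) &
      F g = (-1) ^+ (koszul p (vertex_flags f) (vertex_flags g) (+)
         reorder_sign (vertex_word f) (vertex_word g)) * F f].
Proof.
move=> fg; have /porbitP[i ->] : g \in porbit (sigma G) f by rewrite fg porbit_id.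
elim: i {g fg} => [|i [IH1 IH2 IH3]].
  rewrite expg0 perm1 !perm_refl koszul_refl ?orbit_seq_uniq //.
  by rewrite reorder_sign_refl ?vertex_word_uniq // mul1r.
rewrite expgSr permM; case: (same_vertex_step ((sigma G ^+ i)%g f)) => S1 S2 S3.
split; [exact: perm_trans S1|exact: perm_trans S2|].
exact: sign_block_trans (orbit_seq_uniq _ f) (vertex_word_uniq f) IH1 S1 IH2 S2 IH3 S3.
Qed.

(** The case of [prod_blocks] in which blocks are indexed by starting flags and correspond when they
    belong to the same vertex. *)
Lemma frame_change r r' : orbit_reps (sigma G) r -> orbit_reps (sigma G) r' ->
  \prod_(f <- r') F f =
    (-1) ^+ (koszul p (flatten (map (@vertex_flags G) r)) (flatten (map (@vertex_flags G) r'))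
      (+) reorder_sign (frame_word r) (frame_word r')) * \prod_(f <- r) F f.
Proof.
move=> rr rr'.
have [|||//] := @prod_blocks _ _ _ _ _ (@vertex_flags G) vertex_word p F (porbit (sigma G))
  vertex_parity same_vertex r r'.
- by rewrite (permPl (orbit_reps_porbits rr)) perm_sym orbit_reps_porbits.
- by rewrite (perm_uniq rr) enum_uniq.
- exact: orientation_uniq (frame_word_orientation rr).
Qed.

End Frames.

(** * Marked partition functions *)

Section Edges.

Variables (k : fieldType) (A : super_data k) (b : homog_basis A) (G : ribbon_graph).

Local Notation N := (bdim b).

Definition vertices_word (r : seq (flag G)) := flatten (map (@vertex_flags G) r).

Lemma pairingE (r u : seq (flag G)) (t : tensor b G) :
  pairing r u t = \sum_(x : {ffun flag G -> 'I_N})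
    (-1) ^+ koszul (fun f => ppar (x f)) u (vertices_word r) * t x *
      \prod_(f <- r) alpha [seq x h | h <- vertex_flags f].
Proof. by []. Qed.

Lemma vertices_word_perm (r : seq (flag G)) :
  orbit_reps (sigma G) r -> perm_eq (vertices_word r) (enum (flag G)).
Proof. by []. Qed.

(** Replaces the frame read off from [w] by any other: the change of the two sign factors is
    compensated by [frame_change]. *)
Lemma orient_pairing_frame (w : seq (letter G)) (r u : seq (flag G)) (t : tensor b G) :
  is_orientation w -> orbit_reps (sigma G) r -> perm_eq u (enum (flag G)) ->
  orient_pairing w u t = (-1) ^+ reorder_sign w (frame_word r) * pairing r u t.
Proof.
move=> ww rr uu; have fr := frame_reps ww; rewrite /orient_pairing !pairingE !mulr_sumr.
have uu' : uniq u by rewrite (perm_uniq uu) enum_uniq.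
apply: eq_bigr => x _; rewrite (frame_change x fr rr).
have fo := frame_word_orientation fr; have ro := frame_word_orientation rr.
have ffw : perm_eq (frame_word (frame w)) (frame_word r).
  by rewrite (permPl fo) perm_sym.
have wfw : perm_eq w (frame_word (frame w)).
  by rewrite (permPl ww) perm_sym.
have frv : perm_eq (vertices_word (frame w)) (vertices_word r).
  by rewrite (permPl fr) perm_sym.
have uv : perm_eq u (vertices_word (frame w)) by rewrite (permPl uu) perm_sym.
rewrite (reorder_sign_trans (orientation_uniq ww) wfw ffw) (koszul_trans _ uu' uv frv).
rewrite -!/(vertices_word _).
move: (reorder_sign _ _) (reorder_sign _ _) (koszul _ _ _) (koszul _ _ _) => x1 x2 x3 x4.
by case: x1 x2 x3 x4 => [] [] [] []; rewrite /= ?expr1 ?expr0 ?mulN1r ?mul1r ?mulrN ?mulNr ?opprK.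
Qed.

Definition edges_word (r : seq (flag G)) := flatten [seq [:: f; eta G f] | f <- r].

(* The edges marked by m carry g^-1 = I (g^-1_It) instead of g^-1_It. *)
Definition edge_coef (m : pred (flag G)) (x : flag G -> 'I_N) f :=
  (if m f then @inv_coef k A b else @prop_coef k A b) (x f) (x (eta G f)).

Definition edges_tensor m (r : seq (flag G)) : tensor b G :=
  fun x => \prod_(f <- r) edge_coef m x f.

Lemma orbit_seq_eta f : orbit_seq (eta G) f = [:: f; eta G f].
Proof.
rewrite /orbit_seq (@card_porbit_iter _ _ 2) //= ?eta_invol //.
by rewrite inE eq_sym eta_nofix.
Qed.

Lemma edges_wordE r : edges_word r = flatten (map (orbit_seq (eta G)) r).
Proof. by congr flatten; apply: eq_map => f; rewrite orbit_seq_eta. Qed.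

(** The marked flags form at most one edge. A marked edge carries an odd bivector, so with two of
    them the order of the edges would matter. *)
Definition edge_mark (m : pred (flag G)) :=
  (forall f, m (eta G f) = m f) /\ (forall f g, m f -> m g -> porbit (eta G) f = porbit (eta G) g).

Lemma edges_change m (x : flag G -> 'I_N) (r r' v : seq (flag G)) : edge_mark m ->
  orbit_reps (eta G) r -> orbit_reps (eta G) r' -> perm_eq v (enum (flag G)) ->
  (-1) ^+ koszul (fun f => ppar (x f)) (edges_word r') v * edges_tensor m r' x =
  (-1) ^+ koszul (fun f => ppar (x f)) (edges_word r) v * edges_tensor m r x.
Proof.
case=> m_eta m_one rr rr' vv; set p := fun f => ppar (x f).
(* The label words for [prod_blocks]: one label for an odd block, none for an even one. *)
pose l f := if m f then [:: tt] else [::].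
have parity f : edge_coef m x f != 0 -> odd (count p [:: f; eta G f]) = odd (size (l f)).
  rewrite /edge_coef /l; case: ifP => _ => [/inv_coef_odd|/prop_coef_even] /=.
    by rewrite addn0 oddD !oddb.
  by rewrite addn0 oddD !oddb /p => ->; rewrite addbb.
have same f g : porbit (eta G) f = porbit (eta G) g ->
  [/\ perm_eq [:: f; eta G f] [:: g; eta G g], perm_eq (l f) (l g) & edge_coef m x g =
      (-1) ^+ (koszul p [:: f; eta G f] [:: g; eta G g] (+) reorder_sign (l f) (l g))
        * edge_coef m x f].
  move=> fg; have fNf : f != eta G f by rewrite eq_sym eta_nofix.
  have: g \in porbit (eta G) f by rewrite fg porbit_id.
  rewrite porbit_eta !inE => /orP[] /eqP ->.
    rewrite !perm_refl koszul_refl /= ?inE ?fNf //.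
    rewrite reorder_sign_refl; last by rewrite /l; case: (m f).
    by split; rewrite //= mul1r.
  rewrite /l m_eta perm_refl eta_invol reorder_sign_refl; last by case: ifP.
  have swap : perm_eq [:: f; eta G f] [:: eta G f; f].
    by rewrite -[[:: f; _]]/([:: f] ++ [:: _]) perm_catC.
  split=> //; rewrite (@koszul_swap _ _ [:: f] [:: eta G f]) /= ?inE ?fNf //.
  rewrite !addn0 !oddb addbF /edge_coef m_eta eta_invol; case: ifP => _.
    have [c0|/inv_coef_odd] := eqVneq (inv_coef (x f) (x (eta G f))) 0.
      by rewrite [LHS]inv_coef_sym c0 mulr0.
    rewrite [LHS]inv_coef_sym /p /=.
    by case: (ppar (x f)) (ppar (x (eta G f))) => [] [] // _; rewrite mul1r.
  by rewrite prop_coef_sym andbC.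
have luniq : uniq (flatten (map l r)).
  have: uniq (map (porbit (eta G)) r).
    by rewrite (perm_uniq (orbit_reps_porbits rr)) enum_uniq.
  elim: r {rr} => //= f r IHr /andP[fr /IHr ur]; rewrite cat_uniq ur andbT.
  apply/andP; split; first by rewrite /l; case: (m f).
  apply/hasPn => y /flatten_mapP[g gr]; rewrite /l; case: ifP => // mg _ /=.
  apply: contra fr; case: ifP => // mf _; apply/mapP; exists g => //; exact: m_one.
rewrite /edges_tensor; have [|||wI lI ->] := prod_blocks parity same (s := r) (s' := r').
- by rewrite (permPl (orbit_reps_porbits rr)) perm_sym orbit_reps_porbits.
- by rewrite -/(edges_word r) edges_wordE (perm_uniq rr) enum_uniq.
- exact: luniq.
(* With at most one marked edge the label word has at most one letter, so its rearrangement has no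
   sign. *)
have lE : flatten (map l r) = flatten (map l r').
  apply: perm_small_eq (lI); rewrite -(perm_size lI).
  by apply: (@uniq_leq_size _ _ [:: tt]) => // -[]; rewrite mem_head.
rewrite -lE reorder_sign_refl // addbF mulrA -signr_addb.
congr (_ ^+ nat_of_bool _ * _); rewrite -/(edges_word r) -/(edges_word r').
have wr : perm_eq (edges_word r) (enum (flag G)) by rewrite edges_wordE.
have wr' : perm_eq (edges_word r') (enum (flag G)) by rewrite edges_wordE.
have ur : uniq (edges_word r) by rewrite (perm_uniq wr) enum_uniq.
rewrite (@koszul_trans _ _ (edges_word r) (edges_word r') v) // 1?addbC //.
by rewrite (permPl wr') perm_sym.
Qed.

Lemma edges_word_perm r : orbit_reps (eta G) r -> perm_eq (edges_word r) (enum (flag G)).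
Proof. by rewrite edges_wordE. Qed.

Lemma porbit_edge_flag (e : edge G) : porbit (eta G) (edge_flag e) = val e.
Proof.
have: edge_flag e \in val e by apply: xchooseP.
have /imsetP[f _ ->] : val e \in porbits (eta G) := valP e.
by rewrite -eq_porbit_mem => /eqP.
Qed.

Lemma edge_flags_reps (es : seq (edge G)) : perm_eq es (enum {: edge G}) ->
  orbit_reps (eta G) (map (@edge_flag G) es).
Proof.
move=> ees; apply: porbits_orbit_reps; rewrite -map_comp.
rewrite (eq_map (g := val)); last by move=> e; apply: porbit_edge_flag.
rewrite (permPl (perm_map _ ees)); apply: uniq_perm; rewrite ?enum_uniq //.
  by rewrite map_inj_uniq ?enum_uniq //; exact: val_inj.
move=> v; rewrite mem_enum; apply/mapP/idP => [[e _ ->]|vv]; first exact: valP.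
by exists (exist _ v vv); rewrite ?mem_enum.
Qed.

(** For [m = pred0] this is the partition function, for [m = edge_of e] the value with g^-1 placed
    on [e]. *)
Definition marked_value (m : pred (flag G)) (w : seq (letter G)) : k :=
  let r := map (@edge_flag G) (all_edges G) in
  orient_pairing w (edges_word r) (edges_tensor m r).

Lemma marked_valueE m (w : seq (letter G)) (rv re : seq (flag G)) : edge_mark m ->
  is_orientation w -> orbit_reps (sigma G) rv -> orbit_reps (eta G) re ->
  marked_value m w =
    (-1) ^+ reorder_sign w (frame_word rv) * pairing rv (edges_word re) (edges_tensor m re).
Proof.
move=> mm ww vv ee; have aa := edge_flags_reps (perm_refl (enum {: edge G})).
rewrite /marked_value (orient_pairing_frame _ ww vv) ?edges_word_perm //.
congr (_ * _); rewrite !pairingE; apply: eq_bigr => x _; congr (_ * _).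
by apply: edges_change => //; apply: vertices_word_perm.
Qed.

Definition edge_of (e : edge G) : pred (flag G) := fun f => f \in val e.

Lemma edge_of_mark e : edge_mark (edge_of e).
Proof.
rewrite /edge_of -porbit_edge_flag; split=> [f|f g].
  by rewrite -!eq_porbit_mem porbit_step.
by rewrite -!eq_porbit_mem => /eqP-> /eqP->.
Qed.

Lemma no_mark : edge_mark pred0.
Proof. by split. Qed.

Lemma edge_orderE (es : seq (edge G)) :
  edge_order es = edges_word (map (@edge_flag G) es).
Proof. by rewrite /edge_order /edges_word -map_comp. Qed.

Lemma edge_tensorE (es : seq (edge G)) (x : flag G -> 'I_N) :
  edge_tensor es x = edges_tensor pred0 (map (@edge_flag G) es) x.
Proof. by rewrite /edge_tensor /edges_tensor big_map. Qed.

Lemma pairing_ext (r u : seq (flag G)) (t t' : tensor b G) :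
  t =1 t' -> pairing r u t = pairing r u t'.
Proof. by move=> tt'; rewrite !pairingE; apply: eq_bigr => x _; rewrite tt'. Qed.

Lemma partition_valueE (w : seq (letter G)) : partition_value b w = marked_value pred0 w.
Proof.
rewrite /partition_value /marked_value /orient_pairing edge_orderE; congr (_ * _).
by apply: pairing_ext => x; apply: edge_tensorE.
Qed.

Lemma edge_of_flag (e e' : edge G) : edge_of e (edge_flag e') = (e' == e).
Proof. by rewrite /edge_of -porbit_edge_flag -eq_porbit_mem !porbit_edge_flag. Qed.

(** The Leibniz rule over the edges: the unmarked bivectors are even, so I passes them without a
    sign, and the two terms at the flags of one edge combine by [opI_prop_coef]. *)
Lemma act_I_edges (r : seq (flag G)) (x : flag G -> 'I_N) : uniq (edges_word r) ->
  act_I (edges_word r) (edges_tensor pred0 r) x =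
    \sum_(f <- r) edges_tensor (mem (porbit (eta G) f)) r x.
Proof.
move=> ur; rewrite /act_I {1}/edges_word big_flatten big_map /=.
apply: eq_big_seq => f fr; rewrite big_cons big_seq1.
case/splitPr: r / fr ur => a c.
have -> : edges_word (a ++ f :: c) = edges_word a ++ f :: eta G f :: edges_word c.
  by rewrite /edges_word map_cat flatten_cat.
rewrite cat_uniq => /and3P[_ /hasPn fa /and3P[fc fc' _]].
have fNa : f \notin edges_word a by apply: fa; rewrite mem_head.
have f'Na : eta G f \notin edges_word a by apply: fa; rewrite !inE eqxx orbT.
have f'f : (f == eta G f) = false by rewrite eq_sym (negPf (eta_nofix f)).
have notin g s : f \notin edges_word s -> eta G f \notin edges_word s -> g \in s ->
    [/\ (g == f) = false, (g == eta G f) = false, (eta G g == f) = false &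
         (eta G g == eta G f) = false].
  move=> fs f's gs; have gw : g \in edges_word s.
    by apply/flatten_mapP; exists g; rewrite // mem_head.
  have gw' : eta G g \in edges_word s.
    by apply/flatten_mapP; exists g; rewrite // !inE eqxx orbT.
  by split; apply: contraTF isT => /eqP eqg; [move: gw fs|move: gw f's|move: gw' fs|move: gw' f's];
    rewrite eqg => ->.
have f_c : f \notin edges_word c by move: fc; rewrite inE negb_or => /andP[].
have unchanged (h : flag G) i s : (h == f) || (h == eta G f) ->
    f \notin edges_word s -> eta G f \notin edges_word s ->
    edges_tensor pred0 s [eta x with h |-> i] = edges_tensor pred0 s x.
  move=> hf fs f's; apply: eq_big_seq => g /(notin g s fs f's)[g1 g2 g3 g4].
  by rewrite /edge_coef /=; case/orP: hf => /eqP->; rewrite ?g1 ?g2 ?g3 ?g4.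
have unmarked s : f \notin edges_word s -> eta G f \notin edges_word s ->
    edges_tensor (mem (porbit (eta G) f)) s x = edges_tensor pred0 s x.
  move=> fs f's; apply: eq_big_seq => g /(notin g s fs f's)[g1 g2 g3 g4].
  by rewrite /edge_coef /= porbit_eta !inE g1 g2.
have sign_a : (-1) ^+ (\sum_(h <- edges_word a) ppar (x h))%N * edges_tensor pred0 a x =
    edges_tensor pred0 a x.
  rewrite /edges_tensor; elim: (a) => [|g s IHs]; first by rewrite !big_nil mul1r.
  rewrite /edges_word /= !big_cons -/(edges_word s) addnA exprD mulrACA IHs.
  congr (_ * _); rewrite /edge_coef /=.
  have [->|/prop_coef_even->] := eqVneq (prop_coef (x g) (x (eta G g))) 0.
    by rewrite mulr0.
  by rewrite addnn -signr_odd odd_double mul1r.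
(* The letters before [f] are those of [a]; those before [eta G f] include also [f], whence the
   extra sign in the second term of [opI_prop_coef]. *)
rewrite index_cat (negPf fNa) /= eqxx addn0 take_size_cat //.
rewrite index_cat (negPf f'Na) /= f'f eqxx addn1 take_cat ltnNge leqnSn /= subSnn /=.
rewrite big_cat big_seq1 /= exprD.
have split_T m y : edges_tensor m (a ++ f :: c) y =
    edges_tensor m a y * (edge_coef m y f * edges_tensor m c y).
  by rewrite /edges_tensor big_cat big_cons.
rewrite split_T !unmarked // /edge_coef /= porbit_id -opI_prop_coef.
transitivity (edges_tensor pred0 a x * ((\sum_i coord (bvec b) (x f) (opI A (tnth (bvec b) i)) *
    prop_coef i (x (eta G f))) * edges_tensor pred0 c x) +
  edges_tensor pred0 a x * (((-1) ^+ ppar (x f) *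
    \sum_i coord (bvec b) (x (eta G f)) (opI A (tnth (bvec b) i)) *
    prop_coef (x f) i) * edges_tensor pred0 c x)); last by rewrite -mulrDr -mulrDl.
congr (_ + _).
  rewrite -[in RHS]sign_a -mulrA; congr (_ * _).
  rewrite mulr_suml mulr_sumr; apply: eq_bigr => i _.
  rewrite split_T !unchanged ?eqxx // /edge_coef /= eqxx eq_sym f'f mulrCA.
  by rewrite !mulrA.
rewrite -[in RHS]sign_a -!mulrA; congr (_ * _); rewrite [RHS]mulrCA; congr (_ * _).
rewrite mulr_suml mulr_sumr; apply: eq_bigr => i _.
rewrite split_T !unchanged ?eqxx ?orbT // /edge_coef /= eqxx f'f mulrCA.
by rewrite !mulrA.
Qed.

End Edges.

(** * Vanishing of the total I-variation *)

(** An odd operator at [f] changes the parity of that factor. The two corrections are its signs of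
    passing to [f] in the order [u] of the tensor and in the order [v] of the functionals. *)
Lemma koszul_flip (T : eqType) (p q : pred T) (f : T) (u v : seq T) :
  uniq u -> perm_eq u v -> f \in u -> q f = ~~ p f -> (forall x, x != f -> p x = q x) ->
  koszul q u v = koszul p u v (+) odd (count p (take (index f u) u))
                              (+) odd (count p (take (index f v) v)).
Proof.
(* The letters before [f] have the same parity for [p] and [q], so the roles of [p] and [q] can be
   exchanged. *)
wlog pf : p q / p f.
  move=> wlog_pf uu uv fu qf pq; have [pf|npf] := boolP (p f); first exact: wlog_pf.
  have countq s : count q (take (index f s) s) = count p (take (index f s) s).
    apply: eq_in_count => x xs; rewrite pq //; apply: contraL xs => /eqP->.
    by rewrite in_take_leq ?index_size // ltnn.
  have pf : p f = ~~ q f by rewrite qf negbK.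
  have qp x : x != f -> q x = p x by move=> xf; rewrite pq.
  rewrite (wlog_pf q p _ uu uv fu pf qp) ?qf // !countq.
  move: (odd (count p (take (index f u) u))) (odd (count p (take (index f v) v))) => x y.
  by case: (koszul q u v) x y => [] [] [].
move=> uu uv fu qf pq; have uv' : uniq v by rewrite -(perm_uniq uv).
have fv : f \in v by rewrite -(perm_mem uv).
have remE s : uniq s -> rem f (filter p s) = filter q s.
  move=> us; rewrite rem_filter ?filter_uniq // -filter_predI; apply: eq_filter => x /=.
  by have [->|xf] := eqVneq x f; [rewrite qf pf | rewrite pq].
have idxE s : f \in s -> index f (filter p s) = count p (take (index f s) s).
  elim: s => //= x s IHs; rewrite inE; have [->|xf] := eqVneq x f.
    by rewrite pf /= eqxx.
  move=> /= /IHs fs.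
  by case: ifP => px /=; rewrite ?(negPf xf) fs.
rewrite /koszul (@reorder_sign_front _ f (filter p u)) ?filter_uniq ?perm_filter //; last first.
  by rewrite mem_filter pf.
rewrite !remE // !idxE //.
move: (odd (count p (take (index f u) u))) (odd (count p (take (index f v) v))) => x y.
by case: (reorder_sign _ _) x y => [] [] [].
Qed.

Section Closedness.

Variables (k : fieldType) (A : super_data k) (b : homog_basis A) (G : ribbon_graph).

Local Notation N := (bdim b).
Local Notation e := (tnth (bvec b)).

Let vertex_opI (y : flag G -> 'I_N) (g : flag G) :
  \sum_(f <- vertex_flags g)
     (-1) ^+ (\sum_(h <- take (index f (vertex_flags g)) (vertex_flags g)) ppar (y h))%N *
     \sum_j coord (bvec b) j (opI A (e (y f))) *
       alpha [seq [eta y with f |-> j] h | h <- vertex_flags g] = 0.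
Proof.
set s := vertex_flags g; have us : uniq s := orbit_seq_uniq _ g.
have ss : (3 <= size s)%N by rewrite size_traject sigma_ge3.
rewrite -[RHS](@alpha_opI _ _ b (y g) (map y s)) ?size_map; last exact: ltnW.
rewrite (big_nth g); apply: eq_big_nat => n /andP[_ ltns].
rewrite index_uniq // (nth_map g) // -map_take count_map.
congr (_ * _).
  rewrite -[LHS]signr_odd; congr (_ ^+ nat_of_bool (odd _)).
  by rewrite -sum1_count [RHS]big_mkcond; apply: eq_bigr => h _ /=; case: (ppar _).
apply: eq_bigr => j _; congr (_ * alpha _).
set f := nth g s n; have sE : s = take n s ++ f :: drop n.+1 s.
  by rewrite -drop_nth // cat_take_drop.
have : uniq (take n s ++ f :: drop n.+1 s) by rewrite -sE.
rewrite cat_uniq => /and3P[_ /hasPn ftake /andP[fdrop _]].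
transitivity (map [eta y with f |-> j] (take n s ++ f :: drop n.+1 s)); first by rewrite -sE.
rewrite map_cat /= eqxx -map_drop; congr (_ ++ _ :: _); apply/eq_in_map => h hs /=.
  by case: eqP => // hE; case/negP: (ftake f (mem_head _ _)); rewrite -hE.
by case: eqP => // hE; rewrite -hE hs in fdrop.
Qed.

Let vertices_opI (y : flag G -> 'I_N) (r : seq (flag G)) : uniq (vertices_word r) ->
  \sum_(f <- vertices_word r)
     (-1) ^+ (\sum_(h <- take (index f (vertices_word r)) (vertices_word r)) ppar (y h))%N *
     \sum_j coord (bvec b) j (opI A (e (y f))) *
       \prod_(g <- r) alpha [seq [eta y with f |-> j] h | h <- vertex_flags g] = 0.
Proof.
move=> ur; rewrite {1}/vertices_word big_flatten big_map big1_seq // => g /andP[_ gr].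
case/splitPr: r / gr ur => a c.
have -> : vertices_word (a ++ g :: c) = vertices_word a ++ vertex_flags g ++ vertices_word c.
  by rewrite /vertices_word map_cat flatten_cat.
move=> ur.
have := ur; rewrite cat_uniq => /and3P[_ /hasPn ga].
rewrite cat_uniq => /and3P[_ /hasPn gc _].
have fixed s f j : f \notin vertices_word s ->
    \prod_(h <- s) alpha [seq [eta y with f |-> j] x | x <- vertex_flags h] =
    \prod_(h <- s) alpha [seq y x | x <- vertex_flags h].
  move=> fs; apply: eq_big_seq => h hs; congr alpha; apply/eq_in_map => x xh /=.
  by case: eqP => // xf; case/negP: fs; apply/flatten_mapP; exists h; rewrite -?xf.
rewrite -[RHS](mulr0 ((-1) ^+ (\sum_(h <- vertices_word a) ppar (y h))%N *
  ((\prod_(h <- a) alpha [seq y x | x <- vertex_flags h]) *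
   (\prod_(h <- c) alpha [seq y x | x <- vertex_flags h])))).
rewrite -[in RHS](vertex_opI y g) mulr_sumr; apply: eq_big_seq => f fg.
have fa : f \notin vertices_word a by apply: ga; rewrite mem_cat fg.
have fc : f \notin vertices_word c by apply: contraL fg => /gc.
rewrite index_cat (negPf fa) index_cat fg take_cat ltnNge leq_addr /= addKn.
rewrite takel_cat ?index_size // big_cat exprD -!mulrA; congr (_ * _).
rewrite [RHS]mulrA [RHS]mulrCA; congr (_ * _).
rewrite mulr_sumr; apply: eq_bigr => j _.
rewrite big_cat big_cons /= !fixed // [RHS]mulrCA; congr (_ * _).
by rewrite -[RHS]mulrA; congr (_ * _); apply: mulrC.
Qed.

(** By adjunction I is moved from the tensor to the vertex functionals, which are closed by
    [vertices_opI]. Extensionality of [t] is assumed because updated assignments are bare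
    functions. *)
Lemma pairing_act_I (r u : seq (flag G)) (t : tensor b G) :
  orbit_reps (sigma G) r -> perm_eq u (enum (flag G)) ->
  (forall x y, x =1 y -> t x = t y) -> pairing r u (act_I u t) = 0.
Proof.
move=> rr uu tE; rewrite pairingE; set v := vertices_word r.
have vv : perm_eq v (enum (flag G)) := rr.
have uuniq : uniq u by rewrite (perm_uniq uu) enum_uniq.
have uv : perm_eq u v by rewrite (permPl uu) perm_sym.
pose upd (y : {ffun flag G -> 'I_N}) f j := [ffun h => if h == f then j else y h].
transitivity (\sum_(y : {ffun flag G -> 'I_N}) (-1) ^+ koszul (fun f => ppar (y f)) u v * t y *
    \sum_(f <- v) (-1) ^+ (\sum_(h <- take (index f v) v) ppar (y h))%N *
     \sum_j coord (bvec b) j (opI A (e (y f))) *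
       \prod_(g <- r) alpha [seq [eta y with f |-> j] h | h <- vertex_flags g]).
  transitivity (\sum_(f <- u) \sum_(x : {ffun flag G -> 'I_N}) \sum_i
      (-1) ^+ koszul (fun f => ppar (x f)) u v *
      ((-1) ^+ (\sum_(h <- take (index f u) u) ppar (x h))%N *
        (coord (bvec b) (x f) (opI A (e i)) * t [eta x with f |-> i])) *
      \prod_(g <- r) alpha [seq x h | h <- vertex_flags g]).
    rewrite exchange_big; apply: eq_bigr => x _ /=.
    rewrite /act_I mulr_sumr mulr_suml; apply: eq_bigr => f _.
    by rewrite mulr_sumr mulr_sumr mulr_suml.
  rewrite (perm_big v uv) /=.
  under [RHS]eq_bigr do rewrite mulr_sumr.
  rewrite [RHS]exchange_big; apply: eq_bigr => f _ /=.
  rewrite pair_big /=.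
  under [RHS]eq_bigr do rewrite !mulr_sumr.
  rewrite pair_big /=.
  (* The index carried at [f] is exchanged with the summation index: input and output of I trade
     places. This exchange is an involution. *)
  rewrite (reindex_onto (fun z : {ffun flag G -> 'I_N} * 'I_N => (upd z.1 f z.2, z.1 f))
     (fun z : {ffun flag G -> 'I_N} * 'I_N => (upd z.1 f z.2, z.1 f))) /=; last first.
    move=> [x i] _ /=; rewrite !ffunE eqxx; congr (_, _); apply/ffunP => h.
    by rewrite !ffunE; case: eqP => // ->.
  apply: eq_big => [[y j]|[y j] _] /=.
    rewrite !ffunE eqxx; apply/eqP; congr (_, _); apply/ffunP => h.
    by rewrite !ffunE; case: eqP => // ->.
  rewrite ffunE eqxx.
  rewrite (tE _ y); last first.
    by move=> h /=; rewrite ffunE; case: eqP => // ->.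
  have prodE : \prod_(g <- r) alpha [seq upd y f j h | h <- vertex_flags g] =
      \prod_(g <- r) alpha [seq [eta y with f |-> j] h | h <- vertex_flags g].
    by apply: eq_bigr => g _; congr alpha; apply: eq_map => h; rewrite ffunE.
  rewrite prodE; set P := \prod_(g <- r) _.
  have [->|cnz] := eqVneq (coord (bvec b) j (opI A (e (y f)))) 0.
    by rewrite !(mul0r, mulr0).
  have flipj := coord_part (opI_odd (bparP (y f))) cnz.
  have fu : f \in u by rewrite (perm_mem uu) mem_enum.
  (* The sign along [u] cancels the one in [act_I]; the sign along [v] is the one required by
     [vertices_opI]. *)
  rewrite (@koszul_flip _ (fun f => ppar (y f)) _ f) //; first last.
  - by move=> h hf; rewrite /upd ffunE (negPf hf).
  - by rewrite ffunE eqxx /ppar flipj.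
  have sumE s : f \notin s -> (\sum_(h <- s) ppar (upd y f j h))%N =
      count (fun h => ppar (y h)) s.
    move=> fs; rewrite -sum1_count [RHS]big_mkcond; apply: eq_big_seq => h hs.
    by rewrite ffunE (negPf (memPn fs h hs)); case: (ppar _).
  have countE s : (\sum_(h <- s) ppar (y h))%N = count (fun h => ppar (y h)) s.
    by rewrite -sum1_count [RHS]big_mkcond; apply: eq_bigr => h _; case: (ppar _).
  rewrite sumE; last by rewrite in_take_leq ?index_size // ltnn.
  rewrite countE -[(-1) ^+ count _ _]signr_odd -[(-1) ^+ count _ _]signr_odd.
  rewrite [X in X * P]mulrA -signr_addb addbAC addbK.
  rewrite signr_addb -!mulrA; congr (_ * _); rewrite [RHS]mulrCA; congr (_ * _).
  by rewrite mulrCA.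
apply: big1 => y _; rewrite vertices_opI ?mulr0 //.
by rewrite (perm_uniq vv) enum_uniq.
Qed.

End Closedness.

(** * Loops and isomorphisms *)

Section LoopValue.

Variables (k : fieldType) (A : super_data k) (b : homog_basis A) (G : ribbon_graph).

Local Notation N := (bdim b).

Lemma orient_pairing_ext (w : seq (letter G)) (u : seq (flag G)) (t t' : tensor b G) :
  t =1 t' -> orient_pairing w u t = orient_pairing w u t'.
Proof. by move=> tt'; rewrite /orient_pairing (pairing_ext _ _ tt'). Qed.

Lemma orient_pairing_sum (I : Type) (s : seq I) (w : seq (letter G)) (u : seq (flag G))
    (t : I -> tensor b G) :
  orient_pairing w u (fun x => \sum_(i <- s) t i x) = \sum_(i <- s) orient_pairing w u (t i).
Proof.
rewrite /orient_pairing -mulr_sumr; congr (_ * _); rewrite exchange_big.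
by apply: eq_bigr => x _; rewrite mulr_sumr mulr_suml.
Qed.

Lemma edges_tensor_mark (m m' : pred (flag G)) (r : seq (flag G)) (x : flag G -> 'I_N) :
  m =1 m' -> edges_tensor m r x = edges_tensor m' r x.
Proof. by move=> mm'; apply: eq_bigr => f _; rewrite /edge_coef mm'. Qed.

Lemma marked_value_mark (m m' : pred (flag G)) (w : seq (letter G)) :
  m =1 m' -> marked_value b m w = marked_value b m' w.
Proof. by move=> mm'; apply: orient_pairing_ext => x; apply: edges_tensor_mark. Qed.

Lemma porbit_mark (f : flag G) : edge_mark (mem (porbit (eta G) f)).
Proof.
split=> [g|g h] /=; first by rewrite -!eq_porbit_mem porbit_step.
by rewrite -!eq_porbit_mem => /eqP-> /eqP->.
Qed.

Lemma act_I_edge_tensor (es : seq (edge G)) (x : flag G -> 'I_N) :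
  uniq (edge_order es) ->
  act_I (edge_order es) (edge_tensor es) x =
    \sum_(e <- es) edges_tensor (edge_of e) (map (@edge_flag G) es) x.
Proof.
rewrite edge_orderE => ur.
transitivity (act_I (edges_word (map (@edge_flag G) es))
    (edges_tensor (b := b) pred0 (map (@edge_flag G) es)) x).
  apply: eq_bigr => f _; congr (_ * _); apply: eq_bigr => i _.
  by rewrite edge_tensorE.
rewrite act_I_edges // big_map; apply: eq_bigr => e _.
by apply: edges_tensor_mark => f; rewrite /= porbit_edge_flag.
Qed.

Lemma edge_order_perm (es : seq (edge G)) : perm_eq es (enum {: edge G}) ->
  perm_eq (edge_order es) (enum (flag G)).
Proof. by move=> /edge_flags_reps/edges_word_perm; rewrite -edge_orderE. Qed.

Lemma marked_value_edges (m : pred (flag G)) (w : seq (letter G)) (es : seq (edge G)) :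
  edge_mark m -> is_orientation w -> perm_eq es (enum {: edge G}) ->
  marked_value b m w =
    orient_pairing w (edge_order es) (edges_tensor (b := b) m (map (@edge_flag G) es)).
Proof.
move=> mm ww ees; rewrite (marked_valueE b mm ww (frame_reps ww) (edge_flags_reps ees)).
by rewrite -edge_orderE.
Qed.

Lemma sum_marked_value (w : seq (letter G)) : is_orientation w ->
  \sum_(e : edge G) marked_value b (edge_of e) w = 0.
Proof.
move=> ww; have ees : perm_eq (all_edges G) (enum {: edge G}) := perm_refl _.
have oo := edge_order_perm ees.
rewrite -big_enum /=.
rewrite (eq_bigr _ (fun e _ => marked_value_edges (edge_of_mark e) ww ees)).
rewrite -orient_pairing_sum.
have uo : uniq (edge_order (all_edges G)) by rewrite (perm_uniq oo) enum_uniq.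
rewrite -(orient_pairing_ext _ _ (fun x => act_I_edge_tensor x uo)).
rewrite /orient_pairing pairing_act_I ?mulr0 //; first exact: frame_reps.
by move=> x y xy; apply: eq_bigr => e _; rewrite !xy.
Qed.

Lemma reg_loop_perm : perm_eq (reg_edges G ++ loop_edges G) (enum {: edge G}).
Proof.
apply: uniq_perm; [|exact: enum_uniq|move=> e].
  rewrite cat_uniq; apply/and3P; split.
  - by rewrite map_inj_uniq ?enum_uniq //; exact: val_inj.
  - apply/hasPn => _ /mapP[l _ ->]; apply/mapP => -[r _ lr].
    by have := valP r; rewrite /= -[sval r]/(val r) -lr; move: (valP l) => /= ->.
  - by rewrite map_inj_uniq ?enum_uniq //; exact: val_inj.
rewrite mem_enum mem_cat; have [le|re] := boolP (is_loop e); apply/orP.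
  by right; apply/mapP; exists (exist _ e le); rewrite ?mem_enum.
by left; apply/mapP; exists (exist _ e re); rewrite ?mem_enum.
Qed.

Lemma loop_valueE (w : seq (letter G)) : is_orientation w ->
  loop_value b w = - \sum_(e : loop_edge G) marked_value b (edge_of (val e)) w.
Proof.
move=> ww; rewrite /loop_value; congr (- _); have ees := reg_loop_perm.
have oo := edge_order_perm ees.
have catE : edge_order (reg_edges G) ++ edge_order (loop_edges G) =
    edge_order (reg_edges G ++ loop_edges G).
  by rewrite /edge_order map_cat flatten_cat.
rewrite catE -big_enum /= -(big_map val xpredT (fun e => marked_value b (edge_of e) w)) /=.
rewrite -/(loop_edges G).
rewrite (eq_bigr _ (fun e _ => marked_value_edges (edge_of_mark e) ww ees)).
rewrite -orient_pairing_sum; apply: orient_pairing_ext => x.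
rewrite act_I_edge_tensor; last first.
  have : uniq (edge_order (reg_edges G ++ loop_edges G)) by rewrite (perm_uniq oo) enum_uniq.
  by rewrite -catE cat_uniq => /and3P[].
rewrite mulr_sumr; apply: eq_big_seq => l ll.
rewrite map_cat [RHS]/edges_tensor big_cat /=; congr (_ * _).
rewrite edge_tensorE /edges_tensor !big_map; apply: eq_bigr => e _.
rewrite /edge_coef /= edge_of_flag; case: eqP => // el.
have /mapP[l' _ ll'] := ll; have := valP e; rewrite /= el ll'.
by move: (valP l') => /= ->.
Qed.

Lemma Z_loop_edges (w : seq (letter G)) : is_orientation w ->
  Z_loop b w = - \sum_(e : loop_edge G) marked_value b (edge_of (val e)) w.
Proof.
move=> ww; rewrite /Z_loop; case: ifP => [_|no_loop]; first exact: loop_valueE.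
rewrite big_pred0 ?oppr0 // => e; apply/negP => _; move/negP: no_loop; apply.
by apply/card_gt0P; exists e.
Qed.

(** Loops as sets of flags instead of elements of a type depending on [G], so that an isomorphism
    acts on them by direct image. *)
Definition loop_sets : {set {set flag G}} :=
  [set v in porbits (eta G) | [exists u in vertices G, v \subset u]].

Lemma Z_loopE (w : seq (letter G)) : is_orientation w ->
  Z_loop b w = - \sum_(v in loop_sets) marked_value b (mem v) w.
Proof.
move=> ww; rewrite Z_loop_edges //; congr (- _).
have -> : loop_sets = [set val (val e) | e : loop_edge G].
  apply/setP => v; rewrite inE; apply/andP/imsetP => [[vv lv]|[e _ ->]].
    by exists (exist _ (exist _ v vv) lv).
  by split; [exact: (valP (val e)) | exact: (valP e)].
by rewrite big_imset // => e e' _ _ /val_inj /val_inj.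
Qed.

End LoopValue.

(** * Transport along isomorphisms of ribbon graphs *)

Section Equivariance.

Variables (T T' : finType) (s : {perm T}) (s' : {perm T'}) (phi : T -> T').
Hypothesis phi_inj : injective phi.
Hypothesis phi_s : forall x, phi (s x) = s' (phi x).

Lemma orbit_seq_map x : orbit_seq s' (phi x) = map phi (orbit_seq s x).
Proof.
have tr n y : traject s' (phi y) n = map phi (traject s y n).
  by elim: n y => //= n IHn y; rewrite -phi_s IHn.
have it n y : iter n s' (phi y) = phi (iter n s y).
  by elim: n => //= n ->.
rewrite {1}/orbit_seq (@card_porbit_iter _ _ #|porbit s x|) ?tr //.
- by rewrite lt0n; exact: card_porbit_neq0.
- by rewrite it iter_porbit.
- by rewrite map_inj_uniq // uniq_traject_porbit.
Qed.

Lemma porbit_map x : porbit s' (phi x) = phi @: porbit s x.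
Proof.
apply/setP => y; rewrite -mem_orbit_seq orbit_seq_map; apply/mapP/imsetP.
  by case=> z; rewrite mem_orbit_seq => zx ->; exists z.
by case=> z zx ->; exists z; rewrite ?mem_orbit_seq.
Qed.

Lemma flatten_orbit_seq_map r :
  flatten (map (orbit_seq s') (map phi r)) = map phi (flatten (map (orbit_seq s) r)).
Proof.
rewrite map_flatten -!map_comp; congr flatten; apply: eq_map => x.
exact: orbit_seq_map.
Qed.

Lemma orbit_reps_map r : bijective phi -> orbit_reps s r -> orbit_reps s' (map phi r).
Proof.
case=> psi phiK psiK rr; rewrite /orbit_reps flatten_orbit_seq_map.
rewrite (permPl (perm_map _ rr)); apply: uniq_perm; rewrite ?enum_uniq //.
  by rewrite map_inj_uniq ?enum_uniq.
by move=> y; rewrite mem_enum -[y]psiK map_f ?mem_enum.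
Qed.

End Equivariance.

Lemma map_letter_inj (G H : ribbon_graph) (phi : flag G -> flag H) :
  injective phi -> injective (map_letter phi).
Proof.
by move=> phi_inj [f|v] [g|u] //= [] => [/phi_inj ->|/(imset_inj phi_inj) ->].
Qed.

Section Isomorphism.

Variables (k : fieldType) (A : super_data k) (b : homog_basis A).
Variables (G H : ribbon_graph) (phi : flag G -> flag H).
Hypothesis phi_iso : graph_iso phi.

Let phi_bij : bijective phi. Proof. by case: phi_iso. Qed.
Let phi_inj : injective phi. Proof. exact: bij_inj. Qed.
Let phi_sigma f : phi (sigma G f) = sigma H (phi f). Proof. by case: phi_iso. Qed.
Let phi_eta f : phi (eta G f) = eta H (phi f). Proof. by case: phi_iso. Qed.

Let map_frame_word r : map (map_letter phi) (frame_word r) = frame_word (map phi r).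
Proof.
rewrite /frame_word map_flatten -!map_comp; congr flatten; apply: eq_map => f /=.
rewrite (porbit_map phi_inj phi_sigma) -map_comp; congr (_ :: _).
rewrite -[vertex_flags (phi f)]/(orbit_seq _ _) (orbit_seq_map phi_inj phi_sigma).
by rewrite -map_comp.
Qed.

Lemma map_letter_orientation w : is_orientation w -> is_orientation (map (map_letter phi) w).
Proof.
move=> ww; have rr := frame_reps ww; have fw := frame_word_orientation rr.
have wfw : perm_eq w (frame_word (frame w)) by rewrite (permPl ww) perm_sym.
rewrite /is_orientation (permPl (perm_map _ wfw)) map_frame_word.
exact: frame_word_orientation (orbit_reps_map phi_inj phi_sigma phi_bij rr).
Qed.

(** By [marked_valueE] the value on [H] may be computed from the images of the frame and of the edge
    list of [G]; all words then correspond letter by letter. *)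
Lemma marked_value_iso m w : edge_mark m -> is_orientation w ->
  marked_value b m (map (map_letter phi) w) = marked_value b (m \o phi) w.
Proof.
move=> mm ww; have rr := frame_reps ww; have mw := map_letter_orientation ww.
have ee := edge_flags_reps (perm_refl (enum {: edge G})).
set re := map _ _ in ee.
have mm' : edge_mark (m \o phi).
  case: mm => m1 m2; split=> [f|f g mf mg] /=; first by rewrite phi_eta m1.
  by apply: (imset_inj phi_inj); rewrite -!(porbit_map phi_inj phi_eta); apply: m2.
rewrite (marked_valueE b mm' ww rr ee).
rewrite (marked_valueE b mm mw (orbit_reps_map phi_inj phi_sigma phi_bij rr)
  (orbit_reps_map phi_inj phi_eta phi_bij ee)).
rewrite -map_frame_word reorder_sign_map; last exact: map_letter_inj phi_inj.
congr (_ * _); rewrite !pairingE.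
have [psi phiK psiK] := phi_bij.
rewrite (reindex (fun x : {ffun flag G -> 'I_(bdim b)} => [ffun h => x (psi h)])) /=; last first.
  exists (fun y : {ffun flag H -> 'I_(bdim b)} => [ffun f => y (phi f)]) => x _;
    by apply/ffunP => f; rewrite !ffunE ?phiK ?psiK.
apply: eq_bigr => x _.
have edgesE : edges_word (map phi re) = map phi (edges_word re).
  by rewrite !edges_wordE (flatten_orbit_seq_map phi_inj phi_eta).
have vertsE : vertices_word (map phi (frame w)) = map phi (vertices_word (frame w)).
  exact: (flatten_orbit_seq_map phi_inj phi_sigma).
rewrite edgesE vertsE koszul_map //; congr (_ ^+ nat_of_bool _ * _ * _).
- by apply: eq_koszul => f; rewrite /= ffunE phiK.
- rewrite /edges_tensor big_map; apply: eq_bigr => f _.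
  by rewrite /edge_coef /= -phi_eta !ffunE !phiK.
- rewrite big_map; apply: eq_bigr => f _; congr alpha.
  rewrite -[vertex_flags (phi f)]/(orbit_seq _ _) (orbit_seq_map phi_inj phi_sigma).
  by rewrite -map_comp; apply: eq_map => h; rewrite /= ffunE phiK.
Qed.

Let porbits_map (u : {perm flag G}) (v : {perm flag H}) :
  (forall f, phi (u f) = v (phi f)) ->
  porbits v = (fun w : {set flag G} => phi @: w) @: porbits u.
Proof.
move=> phi_uv; apply/setP => w; apply/imsetP/imsetP => [[h _ ->]|[_ /imsetP[f _ ->] ->]].
  have [psi phiK psiK] := phi_bij; exists (porbit u (psi h)); first exact: imset_f.
  by rewrite -(porbit_map phi_inj phi_uv) psiK.
by exists (phi f); rewrite // (porbit_map phi_inj phi_uv).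
Qed.

Let loop_sets_map : loop_sets H = (fun v : {set flag G} => phi @: v) @: loop_sets G.
Proof.
have subP (u v : {set flag G}) : (phi @: u \subset phi @: v) = (u \subset v).
  apply/idP/idP => [/subsetP uv|]; last exact: imsetS.
  by apply/subsetP => f fu; rewrite -(mem_imset _ _ phi_inj) uv ?imset_f.
rewrite /loop_sets (porbits_map phi_eta) /vertices (porbits_map phi_sigma).
apply/setP => w; rewrite inE; apply/andP/imsetP => [[/imsetP[v vv ->]]|[v]].
  case/existsP => _ /andP[/imsetP[u uu ->]]; rewrite subP => vu.
  by exists v; rewrite // inE vv; apply/existsP; exists u; rewrite uu.
rewrite inE => /andP[vv /existsP[u /andP[uu vu]]] ->; split; first exact: imset_f.
by apply/existsP; exists (phi @: u); rewrite imset_f ?subP.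
Qed.

Lemma Z_loop_iso w : is_orientation w -> Z_loop b (map (map_letter phi) w) = Z_loop b w.
Proof.
move=> ww; rewrite !Z_loopE //; last exact: map_letter_orientation.
rewrite loop_sets_map big_imset /=; last by move=> u v _ _; apply: (imset_inj phi_inj).
congr (- _); apply: eq_bigr => v; rewrite inE => /andP[vv _].
have [f _ vE] := imsetP vv.
rewrite marked_value_iso //.
  by apply: marked_value_mark => h; rewrite /= mem_imset.
rewrite vE -(porbit_map phi_inj phi_eta).
exact: porbit_mark.
Qed.

End Isomorphism.

(** * The cochain property *)

Section Cochains.

Variables (k : fieldType) (A : super_data k) (b : homog_basis A).

Let marked_value_reorder (G : ribbon_graph) m (w w' : seq (letter G)) : edge_mark m ->
  is_orientation w -> is_orientation w' ->
  marked_value b m w' = (-1) ^+ reorder_sign w w' * marked_value b m w.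
Proof.
move=> mm ww ww'; have rr := frame_reps ww.
have ee := edge_flags_reps (perm_refl (enum {: edge G})).
have fw := frame_word_orientation rr.
rewrite (marked_valueE b mm ww' rr ee) (marked_valueE b mm ww rr ee) mulrA -signr_addb.
have w'w : perm_eq w' w by rewrite (permPl ww') perm_sym.
rewrite (@reorder_sign_trans _ w' w) ?(orientation_uniq ww') //; last first.
  by rewrite (permPl ww) perm_sym.
by rewrite [reorder_sign w w'](reorder_sign_sym (orientation_uniq ww') w'w).
Qed.

Lemma Z_It_cochain : is_cochain (Z_It b).
Proof.
split=> [G w w' _ ww ww'|G H phi w _ ww phi_iso]; rewrite /Z_It !partition_valueE.
  exact: marked_value_reorder (no_mark G) ww ww'.
by rewrite (marked_value_iso b phi_iso (no_mark H)).
Qed.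

Lemma Z_loop_cochain : is_cochain (Z_loop b).
Proof.
split=> [G w w' _ ww ww'|G H phi w _ ww phi_iso]; last exact: Z_loop_iso.
rewrite !Z_loopE // mulrN mulr_sumr; congr (- _); apply: eq_bigr => v.
rewrite inE => /andP[/imsetP[f _ ->] _].
exact: marked_value_reorder (porbit_mark f) ww ww'.
Qed.

End Cochains.

(** * Contraction of a regular edge *)

Section ContractedEdge.

Variables (G : ribbon_graph) (e : reg_edge G).

Let E : {set flag G} := val (val e).
Let f0 := edge_flag (val e).
Let f1 := eta G f0.
(** For the vertices (f0 A) and (f1 B), [tail f0] is A and [tail f1] is B. *)
Let tail f := behead (orbit_seq (sigma G) f).

Let f0E : f0 \in E. Proof. exact: xchooseP. Qed.
Let f1E : f1 \in E. Proof. exact: edge_eta. Qed.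
Let memE f : (f \in E) = (f == f0) || (f == f1).
Proof. by rewrite (edge_mem f0E) !inE. Qed.
Let f01 : f0 != f1. Proof. by rewrite eq_sym eta_nofix. Qed.

Let size_tail f : size (tail f) = #|porbit (sigma G) f|.-1.
Proof. by rewrite size_behead size_traject. Qed.

Let tail_notin y z : y \in E -> z \in tail y -> z \notin E.
Proof.
move=> yE zy; have := orbit_seq_uniq (sigma G) y.
rewrite orbit_seq_behead /= -/(tail y) => /andP[yn _].
rewrite (edge_mem yE) !inE negb_or (memPn yn) //=.
apply: contraNneq (edge_reg yE) => <-.
by rewrite -mem_orbit_seq orbit_seq_behead inE -/(tail y) zy orbT.
Qed.

Let iter_skip y i : y \in E -> (i < size (tail y))%N ->
  iter i (skip e) (sigma G y) = iter i.+1 (sigma G) y.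
Proof.
move=> yE; elim: i => // i IHi ltin; rewrite iterS IHi ?(ltnW ltin) // /skip.
rewrite -iterS ifN //; apply: tail_notin yE _.
rewrite /tail /orbit_seq size_tail in ltin *.
case: #|_| ltin => //= n ltin; apply/trajectP; exists i.+1 => //.
by rewrite -iterSr.
Qed.

(** At the end of one tail the successor would be [y] itself, so [skip] jumps to the first flag of
    the other tail. *)
Let iter_skip_end y : y \in E ->
  iter (size (tail y)) (skip e) (sigma G y) = sigma G (eta G y).
Proof.
move=> yE; have := sigma_ge3 y; have := iter_porbit (sigma G) y.
have := @iter_skip y (size (tail y)).-1 yE; rewrite size_tail.
case: #|_| => [|[|n]] //= /(_ (leqnn _)) -> it _.
by rewrite /skip -iterS it yE.
Qed.

Let traject_skip y : y \in E -> traject (skip e) (sigma G y) (size (tail y)) = tail y.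
Proof.
move=> yE; have tailE : tail y = traject (sigma G) (sigma G y) (size (tail y)).
  by rewrite size_tail /tail /orbit_seq; case: #|_| (card_porbit_neq0 (sigma G) y).
apply: (@eq_from_nth _ (sigma G y)); rewrite size_traject // => i lti.
by rewrite nth_traject // iter_skip // [in RHS]tailE nth_traject // -iterSr.
Qed.

Let val_csigma (x : cflag e) : val (csigma e x) = skip e (val x).
Proof. by rewrite permE. Qed.

Let iter_csigma n (x : cflag e) : val (iter n (csigma e) x) = iter n (skip e) (val x).
Proof. by elim: n => // n IHn; rewrite !iterS val_csigma IHn. Qed.

Let traject_csigma n (x : cflag e) :
  map val (traject (csigma e) x n) = traject (skip e) (val x) n.
Proof. by elim: n x => //= n IHn x; rewrite IHn val_csigma. Qed.

(** The new vertex is read from the first flag of A, so that its word is A B, with [l0] and [l1] the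
    lifts of A and B. *)
Let x0 : cflag e := exist _ (sigma G f0) (sigma_eta_notin f0E).
Let l0 := traject (csigma e) x0 (size (tail f0)).
Let l1 := traject (csigma e) (iter (size (tail f0)) (csigma e) x0) (size (tail f1)).

Let val_l0 : map val l0 = tail f0.
Proof. by rewrite traject_csigma traject_skip. Qed.

Let val_l1 : map val l1 = tail f1.
Proof. by rewrite traject_csigma iter_csigma iter_skip_end // traject_skip. Qed.

Let uniq_tails : uniq (f0 :: tail f0 ++ f1 :: tail f1).
Proof.
rewrite -cat_cons /tail -!orbit_seq_behead cat_uniq !orbit_seq_uniq andbT /=.
apply/hasPn => x; rewrite /= !mem_orbit_seq => x1; apply: contra (edge_reg f0E) => xf.
rewrite -eq_porbit_mem in x1; rewrite -eq_porbit_mem in xf.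
by rewrite -eq_porbit_mem eq_sym -(eqP xf) (eqP x1).
Qed.

Let flags_x0 : vertex_flags (x0 : flag (contract e)) = l0 ++ l1.
Proof.
rewrite -trajectD; congr traject; apply: card_porbit_iter.
- by rewrite addn_gt0 size_tail -subn1 subn_gt0 (ltn_trans _ (sigma_ge3 f0)).
- apply: val_inj; rewrite iter_csigma addnC iterD /= iter_skip_end // iter_skip_end //.
  by rewrite eta_invol.
- rewrite trajectD -(map_inj_uniq val_inj) map_cat val_l0 val_l1.
  by apply: subseq_uniq uniq_tails; rewrite -cat1s -[f1 :: _]cat1s -[X in subseq X]cat0s
    cat_subseq ?sub0seq // cat_subseq // -[X in subseq X]cat0s cat_subseq ?sub0seq.
Qed.

Let flags_far (x : flag (contract e)) : [disjoint porbit (sigma G) (val x) & E] ->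
  map val (vertex_flags x) = vertex_flags (val x).
Proof.
move=> dis; have it i : iter i (skip e) (val x) = iter i (sigma G) (val x).
  elim: i => //= i ->; rewrite /skip ifN //; apply: contraL dis => zE.
  apply/pred0Pn; exists (iter i.+1 (sigma G) (val x)); rewrite /= -iterS zE andbT.
  by rewrite -permX mem_porbit.
have tr : traject (skip e) (val x) #|porbit (sigma G) (val x)| = vertex_flags (val x).
  apply: (@eq_from_nth _ (val x)); rewrite !size_traject // => i lti.
  by rewrite !nth_traject // it.
rewrite -tr -traject_csigma; congr (map val (traject _ _ _)).
apply: card_porbit_iter.
- by rewrite lt0n card_porbit_neq0.
- by apply: val_inj; rewrite iter_csigma it iter_porbit.
- by rewrite -(map_inj_uniq val_inj) traject_csigma tr; apply: orbit_seq_uniq.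
Qed.

Let far (f : flag G) : bool := [disjoint porbit (sigma G) f & E].

Let far_notin f h : far f -> h \in E -> porbit (sigma G) f != porbit (sigma G) h.
Proof.
move=> ff hE; apply: contraL ff => /eqP fh; apply/pred0Pn; exists h.
by rewrite /= fh porbit_id hE.
Qed.

Variable r : seq (flag G).
Hypothesis r_reps : orbit_reps (sigma G) r.

Let s := filter far r.

(** The frame adapted to [e]: its two end vertices start at [f0] and [f1], and the vertices away
    from [e] keep their starting flags from [r]. *)
Let uncontracted_reps : orbit_reps (sigma G) (f0 :: f1 :: s).
Proof.
have rp := orbit_reps_porbits r_reps.
have notin h : h \in E -> porbit (sigma G) h \notin map (porbit (sigma G)) s.
  move=> hE; apply/mapP => -[f]; rewrite mem_filter => /andP[ff _] hf.
  by have := far_notin ff hE; rewrite hf eqxx.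
apply: porbits_orbit_reps; apply: uniq_perm; rewrite ?enum_uniq //=.
  rewrite inE negb_or !notin // !andbT; apply/andP; split.
    by rewrite eq_sym eq_porbit_mem; exact: edge_reg f0E.
  apply: (subseq_uniq (map_subseq _ (filter_subseq _ _))).
  by rewrite (perm_uniq rp) enum_uniq.
move=> v; rewrite !inE mem_enum; apply/idP/idP.
  case/or3P=> [/eqP->|/eqP->|/mapP[f _ ->]]; exact: imset_f.
move=> vv; have : v \in map (porbit (sigma G)) r by rewrite (perm_mem rp) mem_enum.
case/mapP => f fr vE; have [ff|] := boolP (far f).
  by apply/or3P/Or33; rewrite vE map_f // mem_filter ff.
rewrite /far => /pred0Pn[h /andP[/= hf hE]].
have {vv}-> : v = porbit (sigma G) h by rewrite vE; apply/eqP; rewrite eq_sym eq_porbit_mem.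
by move: hE; rewrite memE => /orP[] /eqP->; rewrite eqxx ?orbT.
Qed.

Let far_E f : far f -> f \notin E.
Proof. by move=> ff; apply/negP => fE; have := far_notin ff fE; rewrite eqxx. Qed.

Let s' : seq (flag (contract e)) := pmap insub s.

Let val_s' : map val s' = s.
Proof.
rewrite /s' (pmap_filter (@insubK _ _ _)); apply/all_filterP/allP => f.
by rewrite mem_filter => /andP[/far_E fE _]; rewrite isSome_insub.
Qed.

Let s'_far x : x \in s' -> far (val x).
Proof. by move=> /(map_f val); rewrite val_s' mem_filter => /andP[]. Qed.

Let far_words : map val (vertices_word s') = vertices_word s.
Proof.
rewrite -val_s' /vertices_word map_flatten -!map_comp; congr flatten.
by apply/eq_in_map => x xs /=; rewrite flags_far //; apply: s'_far.
Qed.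

Let uncontracted_word : vertices_word (f0 :: f1 :: s) =
  f0 :: map val l0 ++ f1 :: map val l1 ++ map val (vertices_word s').
Proof.
rewrite far_words val_l0 val_l1 /vertices_word /= -cat_cons -[f1 :: _]cat_cons.
by rewrite /tail -!orbit_seq_behead.
Qed.

Let contracted_word : vertices_word ((x0 : flag (contract e)) :: s') =
  l0 ++ l1 ++ vertices_word s'.
Proof. by rewrite {1}/vertices_word /= -/(vertices_word s') flags_x0 catA. Qed.

Let contracted_reps : orbit_reps (csigma e) ((x0 : flag (contract e)) :: s').
Proof.
change (perm_eq (vertices_word ((x0 : flag (contract e)) :: s')) (enum (flag (contract e)))).
rewrite contracted_word.
have uu : perm_eq (vertices_word (f0 :: f1 :: s)) (enum (flag G)) := uncontracted_reps.
have mu (x : cflag e) : val x \in vertices_word (f0 :: f1 :: s) by rewrite (perm_mem uu) mem_enum.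
have : uniq (vertices_word (f0 :: f1 :: s)) by rewrite (perm_uniq uu) enum_uniq.
rewrite uncontracted_word in mu * => uw.
have vE : map val (l0 ++ l1 ++ vertices_word s') =
    map val l0 ++ map val l1 ++ map val (vertices_word s') by rewrite !map_cat.
apply: uniq_perm; [|exact: enum_uniq|move=> x].
  rewrite -(map_inj_uniq val_inj) vE; apply: subseq_uniq uw.
  by apply: subseq_trans (subseq_cons _ _); apply: cat_subseq => //; apply: subseq_cons.
rewrite mem_enum -(mem_map val_inj) vE; have := mu x; have := valP (x : cflag e).
rewrite memE /= negb_or => /andP[/negPf x0' /negPf x1'].
by rewrite inE x0' mem_cat inE x1' !mem_cat.
Qed.

(** Words of the contracted graph are compared inside [letter G]; the map is injective and so
    preserves signs. It inverts [contract_letter] on the letters that are [fine]. *)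
Let lift : letter (contract e) -> letter G :=
  @map_letter (contract e) G (fun x : cflag e => val x).

Let lift_inj : injective lift.
Proof. by apply: map_letter_inj => x y /val_inj. Qed.

Let fine (a : letter G) : bool :=
  match a with inl f => f \notin E | inr v => [disjoint v & E] end.

Let map_liftK u : all fine u -> map lift (pmap (contract_letter e) u) = u.
Proof.
elim: u => //= a u IHu /andP[fa /IHu]; case: a fa => [f fE|v vE] /=.
  by rewrite insubT /= => ->.
move=> ->; congr (inr _ :: _); apply/setP => f; apply/imsetP/idP => [[x]|fv].
  by rewrite inE => xv ->.
have fE : f \notin E by apply: contraL vE => fE; apply/pred0Pn; exists f; rewrite /= fv.
by exists (exist _ f fE : cflag e); rewrite ?inE.
Qed.

Let rest_fine w : is_orientation w -> all fine (rest_word e w).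
Proof.
move=> ww; apply/allP => a; rewrite mem_filter (perm_mem ww) !inE !negb_or -!/f0 -!/f1.
rewrite /letters mem_cat => /andP[/and4P[av0 af0 av1 af1]].
case/orP => /mapP[]; last first.
  move=> v; rewrite mem_enum => /imsetP[f _ vf] aE; rewrite aE /= in av0 av1 *.
  apply/negPn; apply/negP => /pred0Pn[h /andP[/= hv hE]].
  have vh : v = porbit (sigma G) h.
    by move: hv; rewrite vf -eq_porbit_mem eq_sym => /eqP.
  by move: hE; rewrite memE => /orP[] /eqP hf; move: av0 av1; rewrite vh hf eqxx.
move=> f _ aE; rewrite aE /= in af0 af1 *; rewrite memE negb_or.
by apply/andP; split; [apply: contra af0 | apply: contra af1] => /eqP->.
Qed.

Let edge_word_uniq : uniq (edge_word e).
Proof.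
have : porbit (sigma G) f0 != porbit (sigma G) f1.
  by rewrite eq_sym eq_porbit_mem; exact: edge_reg f0E.
move=> v01; have inlE (f h : flag G) : (inl f == inl h :> letter G) = (f == h) by [].
have inrE (u v : {set flag G}) : (inr u == inr v :> letter G) = (u == v) by [].
have mixE (f : flag G) (v : {set flag G}) : (inl f == inr v :> letter G) = false by [].
by rewrite /edge_word -/f0 -/f1 /= !inE inlE inrE !mixE ![inr _ == inl _]eq_sym !mixE
  (negPf v01) (negPf f01).
Qed.

Let edge_rest_perm w : is_orientation w -> perm_eq w (edge_word e ++ rest_word e w).
Proof.
move=> ww; rewrite -(perm_filterC (mem (edge_word e)) w).
apply: perm_cat; last by rewrite perm_refl.
apply: uniq_perm; [by rewrite filter_uniq // orientation_uniq| exact: edge_word_uniq|].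
move=> a; rewrite mem_filter; apply/andP/idP => [[]//|aw]; split=> //.
rewrite (perm_mem ww) /letters mem_cat; apply/orP.
by move: aw; rewrite !inE => /or4P[] /eqP->; [right|left|right|left];
  rewrite map_f ?mem_enum ?imset_f.
Qed.

Let uncontracted_frame : frame_word (f0 :: f1 :: s) =
  [:: inr (porbit (sigma G) f0); inl f0] ++ map inl (tail f0) ++
  [:: inr (porbit (sigma G) f1); inl f1] ++ map inl (tail f1) ++ frame_word s.
Proof.
rewrite frame_wordE /= /vertex_word -![vertex_flags _]/(orbit_seq (sigma G) _).
by rewrite (orbit_seq_behead _ f0) (orbit_seq_behead _ f1).
Qed.

Let far_rest : rest_word e (frame_word (f0 :: f1 :: s)) =
  map inl (tail f0) ++ map inl (tail f1) ++ frame_word s.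
Proof.
have fr := uncontracted_reps; have fo := frame_word_orientation fr.
have wE := uncontracted_frame.
have : uniq (edge_word e ++ map inl (tail f0) ++ map inl (tail f1) ++ frame_word s).
  rewrite -(perm_uniq (_ : perm_eq (frame_word (f0 :: f1 :: s)) _)) ?orientation_uniq //.
  by rewrite wE perm_cat2l perm_catCA.
rewrite cat_uniq => /and3P[_ /hasPn out _].
have drop_edge u : {subset u <= edge_word e} -> [seq a <- u | a \notin edge_word e] = [::].
  move=> ue; apply/eqP; rewrite -[_ == _]negbK -has_filter; apply/hasPn => a /ue.
  by rewrite negbK.
have keep u : {subset u <= map inl (tail f0) ++ map inl (tail f1) ++ frame_word s} ->
    [seq a <- u | a \notin edge_word e] = u.
  by move=> us; apply/all_filterP/allP => a /us; apply: out.
rewrite /rest_word wE !filter_cat (drop_edge [:: inr _; inl f0]); last first.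
  by move=> a; rewrite !inE => /orP[] ->; rewrite ?orbT.
rewrite (drop_edge [:: inr _; inl f1]); last first.
  by move=> a; rewrite !inE => /orP[] ->; rewrite ?orbT.
by rewrite !keep //; move=> a aw; rewrite !mem_cat aw ?orbT.
Qed.

Let lift_frame : map lift (frame_word s') = frame_word s.
Proof.
rewrite -val_s' /frame_word map_flatten -!map_comp; congr flatten.
apply/eq_in_map => x /s'_far xfar /=; rewrite -map_comp.
rewrite -flags_far // -!map_comp; congr (inr _ :: _); apply/setP => f.
rewrite -[RHS]mem_orbit_seq -[orbit_seq _ _]/(vertex_flags (val x)) -flags_far //.
apply/imsetP/mapP => -[z zx ->]; exists z => //.
  by rewrite -[vertex_flags x]/(orbit_seq (csigma e) x) mem_orbit_seq.
by rewrite -[vertex_flags x]/(orbit_seq (csigma e) x) mem_orbit_seq in zx.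
Qed.

Let porbit_x0 : porbit (csigma e) x0 = new_vertex e.
Proof.
apply/setP => x; rewrite !inE -[LHS]mem_orbit_seq -[orbit_seq _ _]/(@vertex_flags (contract e) x0).
rewrite flags_x0 -(mem_map val_inj) map_cat mem_cat val_l0 val_l1 -/f0 -/f1.
rewrite -!(mem_orbit_seq (sigma G)) (orbit_seq_behead _ f0) (orbit_seq_behead _ f1).
rewrite !inE -/(tail f0) -/(tail f1).
have := valP (x : cflag e); rewrite memE negb_or => /andP[/negPf-> /negPf->].
by [].
Qed.

(** Removing v1, f0, v2, f1 from the adapted frame word leaves A, B and the blocks of the other
    vertices, in the order in which the contracted frame lists them after v0. *)
Let induced_frame : induced_word e (frame_word (f0 :: f1 :: s)) =
  frame_word ((x0 : flag (contract e)) :: s').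
Proof.
have -> : frame_word ((x0 : flag (contract e)) :: s') = inr (porbit (csigma e) x0) ::
    map inl (@vertex_flags (contract e) x0) ++ frame_word s' by [].
rewrite /induced_word porbit_x0; congr (_ :: _); apply: (inj_map lift_inj).
have fo := frame_word_orientation uncontracted_reps.
rewrite map_liftK ?rest_fine // far_rest map_cat lift_frame flags_x0 map_cat.
by rewrite map_cat -catA -!map_comp -val_l0 -val_l1 -!map_comp.
Qed.

Let induced_perm w : is_orientation w ->
  perm_eq (induced_word e w) (induced_word e (frame_word (f0 :: f1 :: s))).
Proof.
move=> ww; rewrite /induced_word perm_cons; apply: perm_pmap; apply: perm_filter.
by rewrite (permPl ww) perm_sym; exact: frame_word_orientation uncontracted_reps.
Qed.

Let induced_orientation w : is_orientation w -> is_orientation (induced_word e w).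
Proof.
move=> ww; rewrite /is_orientation (permPl (induced_perm ww)) induced_frame.
exact: (@frame_word_orientation (contract e) _ contracted_reps).
Qed.

Let contract_sign w : is_orientation w ->
  induced_sign e w (+) reorder_sign (induced_word e w) (frame_word ((x0 : flag (contract e)) :: s'))
  = reorder_sign w (frame_word (f0 :: f1 :: s)).
Proof.
move=> ww; set fw := frame_word (f0 :: f1 :: s).
have fo : is_orientation fw := frame_word_orientation uncontracted_reps.
have fP := edge_rest_perm fo; have wP := edge_rest_perm ww.
have wf : perm_eq w fw by rewrite (permPl ww) perm_sym.
have rP : perm_eq (rest_word e w) (rest_word e fw) by apply: perm_filter.
have eP : perm_eq (edge_word e ++ rest_word e w) (edge_word e ++ rest_word e fw).
  by rewrite perm_cat2l.
have eu : uniq (edge_word e ++ rest_word e w) by rewrite -(perm_uniq wP) orientation_uniq.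
rewrite (reorder_sign_trans (orientation_uniq ww) wP); last first.
  by rewrite (permPl eP) perm_sym.
rewrite (reorder_sign_trans eu eP); last by rewrite perm_sym.
rewrite reorder_sign_cat // reorder_sign_refl ?edge_word_uniq // addFb.
(* Only the pair v2 f1 has to be moved past A, and a block of two letters moves without a sign. *)
have -> : reorder_sign (edge_word e ++ rest_word e fw) fw = false.
  have := orientation_uniq fo; rewrite (perm_uniq fP) /fw far_rest uncontracted_frame.
  rewrite -[edge_word e]/([:: inr (porbit (sigma G) f0); inl f0] ++
    [:: inr (porbit (sigma G) f1); inl f1]) -catA => u4.
  have u4' := u4; rewrite cat_uniq in u4'; case/and3P: u4' => _ _ u4'.
  rewrite reorder_sign_cat //; last by rewrite perm_catCA.
  by rewrite reorder_sign_refl // -koszul_predT koszul_move.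
rewrite addbF; congr (_ (+) _).
have iu := orientation_uniq (induced_orientation ww).
have iP := induced_perm ww.
rewrite -induced_frame -/fw.
have -> : reorder_sign (induced_word e w) (induced_word e fw) =
    reorder_sign (pmap (contract_letter e) (rest_word e w))
      (pmap (contract_letter e) (rest_word e fw)).
  have pP : perm_eq (pmap (contract_letter e) (rest_word e w))
      (pmap (contract_letter e) (rest_word e fw)).
    by move: iP; rewrite /induced_word perm_cons.
  by have := @reorder_sign_cat _ [:: _] _ _ _ iu (perm_refl _) pP; rewrite reorder_sign_refl.
by rewrite -(reorder_sign_map _ _ lift_inj) !map_liftK ?rest_fine.
Qed.

(** * Edge words and pairings under contraction *)

Section ContractedEdges.

Variable q : seq (flag (contract e)).
Hypothesis q_reps : orbit_reps (ceta e) q.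

Let qE : perm_eq (@edges_word (contract e) q) (enum (flag (contract e))).
Proof. exact: (@edges_word_perm (contract e) _ q_reps). Qed.

Let uncontracted_edges : edges_word (f0 :: map val q) =
  f0 :: f1 :: map val (@edges_word (contract e) q).
Proof.
rewrite /edges_word /= map_flatten -!map_comp; congr [:: _, _ & flatten _].
by apply: eq_map => x /=; rewrite permE.
Qed.

Lemma uncontracted_edge_reps : orbit_reps (eta G) (f0 :: map val q).
Proof.
rewrite /orbit_reps -edges_wordE uncontracted_edges.
have notin h : h \in E -> h \notin map val (@edges_word (contract e) q).
  by move=> hE; apply/mapP => -[x _ hx]; have := valP (x : cflag e); rewrite -hx hE.
apply: uniq_perm; [|exact: enum_uniq|move=> h].
  rewrite !cons_uniq inE negb_or f01 !notin //= map_inj_uniq ?(perm_uniq qE) ?enum_uniq //.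
  exact: val_inj.
rewrite mem_enum !inE orbA -memE; case: (boolP (h \in E)) => //= hE.
by apply/mapP; exists (exist _ h hE : cflag e); rewrite // (perm_mem qE) mem_enum.
Qed.

Variables (k : fieldType) (A : super_data k) (b : homog_basis A).
Local Notation N := (bdim b).

(** Assignments on [G] are assignments on the contracted graph with two further indices at [f0] and
    [f1]; the last branch is reached only at [f1]. *)
Let glue (x : {ffun cflag e -> 'I_N}) (ij : 'I_N * 'I_N) : {ffun flag G -> 'I_N} :=
  [ffun h => if insub h is Some z then x z else if h == f0 then ij.1 else ij.2].

Let glue_val x ij z : glue x ij (val z) = x z.
Proof. by rewrite ffunE valK. Qed.

Let glue_f0 x ij : glue x ij f0 = ij.1.
Proof. by rewrite ffunE insubN ?eqxx ?negbK. Qed.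

Let glue_f1 x ij : glue x ij f1 = ij.2.
Proof. by rewrite ffunE insubN ?negbK // eq_sym (negPf f01). Qed.

Let glue_flags x ij (u : seq (cflag e)) : map (glue x ij) (map val u) = map x u.
Proof. by rewrite -map_comp; apply: eq_map => z; rewrite /= glue_val. Qed.

(** The edge word begins with f0 f1, the vertex word with f0 A f1 B. The extra sign is that of [f1]
    passing A, exactly the one in [alpha_inv_coef]. *)
Let glue_koszul x ij :
  koszul (fun f => ppar (glue x ij f)) (edges_word (f0 :: map val q))
    (vertices_word (f0 :: f1 :: s)) =
  koszul (fun z => ppar (x z)) (@edges_word (contract e) q)
    (vertices_word ((x0 : flag (contract e)) :: s')) (+)
  (ppar ij.2 && odd (count (@ppar k A b) (map x l0))).
Proof.
set p := fun f => _; have eE := edges_word_perm uncontracted_edge_reps.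
have vE : perm_eq (vertices_word (f0 :: f1 :: s)) (enum (flag G)) := uncontracted_reps.
have cE : perm_eq (vertices_word ((x0 : flag (contract e)) :: s'))
  (enum (flag (contract e))) := contracted_reps.
have wE : perm_eq (edges_word (f0 :: map val q)) (f0 :: f1 ::
    map val (vertices_word ((x0 : flag (contract e)) :: s'))).
  rewrite uncontracted_edges !perm_cons perm_map // (permPl qE).
  by rewrite perm_sym.
have eu : uniq (edges_word (f0 :: map val q)) by rewrite (perm_uniq eE) enum_uniq.
rewrite (koszul_trans p eu wE); last by rewrite -(permPl wE) (permPl eE) perm_sym.
have -> : koszul p (edges_word (f0 :: map val q)) (f0 :: f1 ::
    map val (vertices_word ((x0 : flag (contract e)) :: s'))) =
    koszul (fun z => ppar (x z)) (@edges_word (contract e) q)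
      (vertices_word ((x0 : flag (contract e)) :: s')).
  rewrite uncontracted_edges in wE eu *.
  have qv : perm_eq (map val (@edges_word (contract e) q))
      (map val (vertices_word ((x0 : flag (contract e)) :: s'))).
    by move: wE; rewrite !perm_cons.
  have := @koszul_cat _ p [:: f0; f1] [:: f0; f1] _ _ eu (perm_refl _) qv => /= ->.
  rewrite koszul_refl ?addFb /= ?inE ?f01 // koszul_map; last exact: val_inj.
  by apply: eq_koszul => z; rewrite /p /= glue_val.
congr (_ (+) _); rewrite contracted_word uncontracted_word !map_cat.
have mid : uniq ([:: f0] ++ [:: f1] ++ map val l0 ++ map val l1 ++ map val (vertices_word s')).
  rewrite /= -!map_cat -contracted_word.
  by rewrite (perm_uniq wE) in eu.
have midP : perm_eq ([:: f1] ++ map val l0 ++ map val l1 ++ map val (vertices_word s'))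
    (map val l0 ++ [:: f1] ++ map val l1 ++ map val (vertices_word s')).
  by rewrite perm_catCA.
have := koszul_cat p mid (perm_refl _) midP => /= ->.
have mid' : uniq ([:: f1] ++ map val l0 ++ map val l1 ++ map val (vertices_word s')).
  by move: mid; rewrite cat_uniq => /and3P[].
have := koszul_move p mid' => /= ->.
rewrite koszul_refl // addFb addn0 oddb /p glue_f1 !count_map; congr (_ && odd _).
by apply: eq_count => z; rewrite /= glue_val.
Qed.

(** The sum over the indices at [f0] and [f1] is carried out by [alpha_inv_coef]. Both tails are
    nonempty since every vertex has valence at least 3. *)
Lemma contract_pairing :
  @pairing k A b (contract e) ((x0 : flag (contract e)) :: s') (@edges_word (contract e) q)
    (edges_tensor pred0 q) =
  pairing (f0 :: f1 :: s) (edges_word (f0 :: map val q))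
    (edges_tensor (b := b) (edge_of (val e)) (f0 :: map val q)).
Proof.
rewrite !pairingE.
rewrite [RHS](reindex (fun z => glue z.1 z.2)) /=; last first.
  exists (fun y : {ffun flag G -> 'I_N} => ([ffun z : cflag e => y (val z)], (y f0, y f1))).
    move=> [x [i j]] _; rewrite glue_f0 glue_f1; congr (_, _).
    by apply/ffunP => z; rewrite ffunE glue_val.
  move=> y _; apply/ffunP => h; rewrite ffunE; case: insubP => [z _ <-|]; first by rewrite ffunE.
  by rewrite negbK memE => /orP[] /eqP->; rewrite ?eqxx // eq_sym (negPf f01).
rewrite -(pair_bigA _ (fun x ij => (-1) ^+ koszul (fun f => ppar (glue x ij f))
  (edges_word (f0 :: map val q)) (vertices_word (f0 :: f1 :: s)) *
  edges_tensor (edge_of (val e)) (f0 :: map val q) (glue x ij) *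
  \prod_(f <- f0 :: f1 :: s) alpha [seq glue x ij h | h <- vertex_flags f])) /=.
apply: eq_bigr => x _.
set K := koszul _ _ _; set P := edges_tensor pred0 q x.
set Q := \prod_(f <- s') alpha [seq x h | h <- vertex_flags f].
transitivity (\sum_i \sum_j (-1) ^+ K * P * Q *
   ((-1) ^+ (ppar j && odd (count (@ppar k A b) (map x l0))) * inv_coef i j *
    (alpha (i :: map x l0) * alpha (j :: map x l1)))).
  under [RHS]eq_bigr do rewrite -mulr_sumr.
  rewrite -mulr_sumr alpha_inv_coef; first last.
  - by rewrite -size_eq0 size_map -(size_map val) val_l1 size_tail -lt0n -subn1 subn_gt0
      (ltn_trans _ (sigma_ge3 _)).
  - by rewrite -size_eq0 size_map -(size_map val) val_l0 size_tail -lt0n -subn1 subn_gt0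
      (ltn_trans _ (sigma_ge3 _)).
  rewrite big_cons flags_x0 map_cat -/Q; move: (alpha _) => a.
  by rewrite mulrA mulrAC.
rewrite pair_bigA; apply: eq_bigr => ij _ /=.
rewrite glue_koszul -/K signr_addb.
have -> : edges_tensor (edge_of (val e)) (f0 :: map val q) (glue x ij) =
    inv_coef ij.1 ij.2 * P.
  rewrite /edges_tensor big_cons big_map /edge_coef {1}/edge_of f0E glue_f0 glue_f1.
  congr (_ * _); apply: eq_bigr => z _; rewrite /edge_of (negPf (valP (z : cflag e))) /=.
  have vz : eta G (val (z : cflag e)) = val (ceta e z) by rewrite permE.
  by rewrite vz !glue_val.
rewrite !big_cons -![vertex_flags _]/(orbit_seq (sigma G) _).
rewrite (orbit_seq_behead _ f0) (orbit_seq_behead _ f1) -/(tail f0) -/(tail f1) /=.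
rewrite -val_l0 -val_l1 !glue_flags glue_f0 glue_f1.
have -> : \prod_(f <- s) alpha [seq glue x ij h | h <- vertex_flags f] = Q.
  rewrite -val_s' big_map; apply: eq_big_seq => z zs; congr alpha.
  by rewrite -flags_far ?glue_flags //; apply: s'_far.
suff AC (a p d c y z t : k) : a * p * t * (d * c * (y * z)) = a * d * (c * p) * (y * (z * t)).
  exact: AC.
ring.
Qed.

End ContractedEdges.

Lemma contract_marked_value (k : fieldType) (A : super_data k) (b : homog_basis A)
    (w : seq (letter G)) : is_orientation w ->
  (-1) ^+ induced_sign e w * Z_It b (induced_word e w) = marked_value b (edge_of (val e)) w.
Proof.
move=> ww; rewrite /Z_It partition_valueE.
have qq := @edge_flags_reps (contract e) _ (perm_refl (enum {: edge (contract e)})).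
rewrite (@marked_valueE _ _ b (contract e) _ _ _ _ (no_mark _) (induced_orientation ww)
  contracted_reps qq).
rewrite (marked_valueE b (edge_of_mark _) ww uncontracted_reps (uncontracted_edge_reps qq)).
by rewrite contract_pairing // mulrA -signr_addb contract_sign.
Qed.

End ContractedEdge.

Theorem theorem14 (k : fieldType) (char_k : ([pchar k] =i pred0)%R)
  (A : super_data k) (b : homog_basis A) :
  [/\ is_cochain (Z_It b),
      is_cochain (Z_loop b) &
      cochain_eq (dual_d (Z_It b)) (Z_loop b)].
Proof.
split; [exact: Z_It_cochain|exact: Z_loop_cochain|move=> G w _ ww].
rewrite /dual_d Z_loop_edges //.
rewrite (eq_bigr _ (fun e _ => contract_marked_value e (frame_reps ww) b ww)).
apply/eqP; rewrite -addr_eq0; apply/eqP; rewrite -[RHS](sum_marked_value b ww).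
rewrite -[in RHS]big_enum -(perm_big _ (reg_loop_perm G)) big_cat !big_map.
by congr (_ + _); rewrite -big_enum.
Qed.
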